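(* Let $C$ be a minimal abstract clone. If $C$ has a nontrivial weakly abelian representation, then $C$ also has a nontrivial abelian representation. Therefore such a clone $C$ must be (up to isomorphism of clones) one of the following: a unary clone (a minimal clone generated by a unary operation); the clone of an affine space (over a prime field); the clone of a (nontrivial) rectangular band; or the clone of a (nontrivial) groupoid that is a $p$-cyclic groupoid or the dual of a $p$-cyclic groupoid, for some prime $p$.
   Context: A concrete clone is a composition-closed collection of finitary operations on some set containing all the projections. An abstract clone is a heterogeneous algebra (with one sort for each arity $n\ge 1$) having constants playing the role of projections and operations satisfying the usual identities of composition of concrete clones. A representation of an abstract clone $C$ is a clone homomorphism from $C$ into the concrete clone of all operations on a set $A$; it gives an algebra $\mathbb{A}$ on $A$ whose basic operations are the images of the elements of $C$ (equivalently, of a generating set of $C$). A clone is trivial if it consists of projections only, and minimal if it has exactly two subclones: itself and the clone of projections. An algebra is trivial if its clone of term operations is trivial; a representation is nontrivial, abelian, weakly abelian, etc. if the corresponding algebra is. For an algebra $\mathbb{A}$, let $\mathcal{M}(\mathbb{A})$ be the set of $2\times 2$ matrices $\begin{pmatrix} t(\mathbf{a},\mathbf{c}) & t(\mathbf{a},\mathbf{d}) \\ t(\mathbf{b},\mathbf{c}) & t(\mathbf{b},\mathbf{d}) \end{pmatrix}$ where $t$ is an $(n+m)$-ary polynomial operation of $\mathbb{A}$ and $\mathbf{a},\mathbf{b}\in A^n$, $\mathbf{c},\mathbf{d}\in A^m$. $\mathbb{A}$ is weakly abelian if $\begin{pmatrix} u & u \\ u & v \end{pmatrix}\in\mathcal{M}(\mathbb{A})$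 implies $u=v$; it is abelian if $\begin{pmatrix} u & u \\ v & w \end{pmatrix}\in\mathcal{M}(\mathbb{A})$ implies $v=w$. A groupoid is a set with one binary operation, written as multiplication; its dual has multiplication $(x,y)\mapsto yx$. The clone of an algebra is its clone of term operations. The clone of an affine space is the clone of all idempotent term operations of a vector space over a field (it is minimal iff the field has $p$ elements for some prime $p$). A rectangular band is an idempotent semigroup satisfying $xyz=xz$. For a prime $p$, a $p$-cyclic groupoid is a groupoid satisfying $xx=x$, $x(yz)=xy$, $(xy)z=(xz)y$ and $(\cdots((xy)y)\cdots)y=x$ (with $p$ factors $y$). *)

(* Defs.v *)
From HB Require Import structures.
From mathcomp Require Import all_boot all_order all_algebra.
From mathcomp Require Import boolp.

Set Implicit Arguments.
Unset Strict Implicit.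
Unset Printing Implicit Defensive.

Import GRing.Theory.
Local Open Scope ring_scope.

(* Clones have sorts for the arities >= 1 only: [cop C n] is the sort of the
   elements of arity [n.+1]. *)
Record abs_clone := AbsClone {
  cop :> nat -> Type;
  cproj : forall n, 'I_n.+1 -> cop n;
  ccomp : forall n m, cop n -> ('I_n.+1 -> cop m) -> cop m;
  ccomp_projl : forall n m (i : 'I_n.+1) (g : 'I_n.+1 -> cop m),
    ccomp (cproj i) g = g i;
  ccomp_projr : forall n (f : cop n), ccomp f (@cproj n) = f;
  ccompA : forall n m k (f : cop n) (g : 'I_n.+1 -> cop m)
      (h : 'I_m.+1 -> cop k),
    ccomp (ccomp f g) h = ccomp f (fun i => ccomp (g i) h) }.

Arguments cproj {a n} i.
Arguments ccomp {a n m} f g.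

Record clone_hom (C D : abs_clone) := CloneHom {
  hom_fun :> forall n, C n -> D n;
  hom_proj : forall n (i : 'I_n.+1), hom_fun (cproj i) = cproj i;
  hom_comp : forall n m (f : C n) (g : 'I_n.+1 -> C m),
    hom_fun (ccomp f g) = ccomp (hom_fun f) (fun i => hom_fun (g i)) }.

Arguments hom_fun {C D} c {n} f.

Definition clone_iso (C D : abs_clone) : Prop :=
  exists phi : clone_hom C D, forall n, bijective (@hom_fun C D phi n).

Definition is_proj (C : abs_clone) (n : nat) (f : C n) : Prop :=
  exists i : 'I_n.+1, f = cproj i.

Definition clone_trivial (C : abs_clone) : Prop :=
  forall n (f : C n), is_proj f.

Record subclone (C : abs_clone) := Subclone {
  sub_mem :> forall n, C n -> Prop;
  sub_proj : forall n (i : 'I_n.+1), sub_mem (cproj i);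
  sub_comp : forall n m (f : C n) (g : 'I_n.+1 -> C m),
    sub_mem f -> (forall i, sub_mem (g i)) -> sub_mem (ccomp f g) }.

Arguments sub_mem {C} s n f.

(* Nontriviality says that the two subclones (the projections and the whole
   of [C]) are distinct. *)
Definition clone_minimal (C : abs_clone) : Prop :=
  ~ clone_trivial C /\
  forall S : subclone C,
    (forall n (f : C n), S n f) \/ (forall n (f : C n), S n f -> is_proj f).

Section CloneOfSubclone.
Variables (C : abs_clone) (S : subclone C).

Let sop (n : nat) := {f : C n | S n f}.

Definition sub_cproj n (i : 'I_n.+1) : sop n := exist _ _ (sub_proj S i).

Definition sub_ccomp n m (f : sop n) (g : 'I_n.+1 -> sop m) : sop m :=
  exist _ (ccomp (sval f) (fun i => sval (g i)))
    (sub_comp (svalP f) (fun i => svalP (g i))).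

Lemma sop_inj n (f g : sop n) : sval f = sval g -> f = g.
Proof. by case: f g => [f Sf] [g Sg] /= fg; apply: eq_exist. Qed.

Lemma sub_ccomp_projl n m (i : 'I_n.+1) (g : 'I_n.+1 -> sop m) :
  sub_ccomp (sub_cproj i) g = g i.
Proof. by apply: sop_inj; rewrite /= ccomp_projl. Qed.

Lemma sub_ccomp_projr n (f : sop n) : sub_ccomp f (@sub_cproj n) = f.
Proof. by apply: sop_inj; rewrite /= ccomp_projr. Qed.

Lemma sub_ccompA n m k (f : sop n) (g : 'I_n.+1 -> sop m)
    (h : 'I_m.+1 -> sop k) :
  sub_ccomp (sub_ccomp f g) h = sub_ccomp f (fun i => sub_ccomp (g i) h).
Proof. by apply: sop_inj; rewrite /= ccompA. Qed.

Definition clone_of : abs_clone :=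
  AbsClone sub_ccomp_projl sub_ccomp_projr sub_ccompA.

End CloneOfSubclone.

Inductive generated (C : abs_clone) (X : forall n, C n -> Prop) :
    forall n, C n -> Prop :=
| Gen_base n (f : C n) : X n f -> generated X f
| Gen_proj n (i : 'I_n.+1) : generated X (cproj i)
| Gen_comp n m (f : C n) (g : 'I_n.+1 -> C m) :
    generated X f -> (forall i, generated X (g i)) -> generated X (ccomp f g).

Definition gen_subclone (C : abs_clone) (X : forall n, C n -> Prop) :
    subclone C :=
  Subclone (@Gen_proj C X) (@Gen_comp C X).

Definition op (A : Type) (n : nat) : Type := ('I_n.+1 -> A) -> A.

Definition op_clone (A : Type) : abs_clone :=
  @AbsClone (op A) (fun n i x => x i)
    (fun n m f g x => f (fun i => g i x))
    (fun n m i g => erefl) (fun n f => erefl) (fun n m k f g h => erefl).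

(* The basic operation with symbol [s] has arity [(ar s).+1]; a nullary
   operation is encoded as a constant unary one. *)
Record algebra := Algebra {
  carrier : Type;
  symb : Type;
  ar : symb -> nat;
  basic : forall s : symb, op carrier (ar s) }.

Inductive basic_op (A : algebra) : forall n, op (carrier A) n -> Prop :=
| Basic_op (s : symb A) : basic_op (@basic A s).

Inductive basic_or_const (A : algebra) : forall n, op (carrier A) n -> Prop :=
| Basic_symb (s : symb A) : basic_or_const (@basic A s)
| Basic_const n (e : carrier A) :
    @basic_or_const A n (fun=> e).

Definition term_ops (A : algebra) : subclone (op_clone (carrier A)) :=
  @gen_subclone (op_clone (carrier A)) (@basic_op A).

Definition poly_ops (A : algebra) : subclone (op_clone (carrier A)) :=
  @gen_subclone (op_clone (carrier A)) (@basic_or_const A).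

Definition term_clone (A : algebra) : abs_clone := clone_of (term_ops A).

Definition alg_trivial (A : algebra) : Prop := clone_trivial (term_clone A).

Definition vcat (A : Type) (n m : nat) (x : 'I_n -> A) (y : 'I_m -> A) :
    'I_(n + m) -> A :=
  fun i => match split i with inl j => x j | inr k => y k end.

(* [in_M A p q r s] : the matrix with rows (p, q) and (r, s) is in M(A). Blocks
   of variables are nonempty here; an empty block can be replaced by a dummy
   variable. The index [n + m.+1] is the arity n.+1 + m.+1. *)
Definition in_M (A : algebra) (p q r s : carrier A) : Prop :=
  exists (n m : nat) (t : op (carrier A) (n + m.+1))
    (a b : 'I_n.+1 -> carrier A) (c d : 'I_m.+1 -> carrier A),
    poly_ops A _ t /\
    [/\ p = t (vcat a c), q = t (vcat a d),
        r = t (vcat b c) & s = t (vcat b d)].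

Definition weakly_abelian (A : algebra) : Prop :=
  forall u v : carrier A, in_M u u u v -> u = v.

Definition abelian_alg (A : algebra) : Prop :=
  forall u v w : carrier A, in_M u u v w -> v = w.

Definition representation (C : abs_clone) (A : Type) : Type :=
  clone_hom C (op_clone A).

Definition rep_alg (C : abs_clone) (A : Type) (phi : representation C A) :
    algebra :=
  @Algebra A {n : nat & C n} (@projT1 _ _)
    (fun s => hom_fun phi (projT2 s)).

Definition unary_clone (C : abs_clone) : Prop :=
  clone_minimal C /\
  exists f : C 0%N, forall n (g : C n),
    generated (fun m (h : C m) => existT C m h = existT C 0%N f) g.

Inductive vect_symb (K : Type) := VZero | VOpp | VAdd | VScale of K.
Arguments VZero {K}.
Arguments VOpp {K}.
Arguments VAdd {K}.

Definition vect_ar (K : Type) (s : vect_symb K) : nat :=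
  if s is VAdd then 1%N else 0%N.

Definition vect_alg (K : fieldType) (V : lmodType K) : algebra :=
  @Algebra V (vect_symb K) (@vect_ar K)
    (fun s => match s return op V (vect_ar s) with
      | VZero => fun=> 0
      | VOpp => fun x => - x ord0
      | VAdd => fun x => x ord0 + x ord_max
      | VScale k => fun x => k *: x ord0
      end).

Section AffineClone.
Variables (K : fieldType) (V : lmodType K).

Let idem_term n (f : op_clone V n) : Prop :=
  term_ops (vect_alg V) n f /\ forall x : V, f (fun=> x) = x.

Lemma idem_term_proj n (i : 'I_n.+1) :
  @idem_term n (@cproj (op_clone V) n i).
Proof. by split; [exact: sub_proj (term_ops (vect_alg V)) _ i |]. Qed.

Lemma idem_term_comp n m (f : op_clone V n) (g : 'I_n.+1 -> op_clone V m) :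
  idem_term f -> (forall i, idem_term (g i)) -> idem_term (ccomp f g).
Proof.
move=> [tf idf] tg; split.
  by apply: (sub_comp (s := term_ops (vect_alg V))) => // i; case: (tg i).
move=> x; rewrite -[RHS]idf /=; congr (f _).
by apply: funext => i; case: (tg i).
Qed.

Definition affine_clone : abs_clone :=
  clone_of (Subclone idem_term_proj idem_term_comp).

End AffineClone.

Definition groupoid_alg (G : Type) (mul : G -> G -> G) : algebra :=
  @Algebra G unit (fun=> 1%N) (fun _ x => mul (x ord0) (x ord_max)).

Definition dual (G : Type) (mul : G -> G -> G) : G -> G -> G :=
  fun x y => mul y x.

Definition rectangular_band (G : Type) (mul : G -> G -> G) : Prop :=
  [/\ associative mul, forall x, mul x x = x
    & forall x y z, mul (mul x y) z = mul x z].

Definition cyclic_groupoid (p : nat) (G : Type) (mul : G -> G -> G) : Prop :=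
  [/\ forall x, mul x x = x,
      forall x y z, mul x (mul y z) = mul x y,
      forall x y z, mul (mul x y) z = mul (mul x z) y
    & forall x y, iter p (fun z => mul z y) x = x].

(* Main.v *)
Require Import Defs.
From HB Require Import structures.
From mathcomp Require Import all_boot all_order all_algebra.
From mathcomp Require Import all_field.
From mathcomp Require Import boolp.
From mathcomp Require Import zify ring.

Set Implicit Arguments.
Unset Strict Implicit.
Unset Printing Implicit Defensive.

Import GRing.Theory.

(** The representation [phi] need not be faithful, and an identity of [A] passes to [C] only if one
    side is a variable. So each isomorphism needs its own proof of injectivity, recovering an
    operation from absorption identities alone: a substitution of finite order, the decomposition of
    an element of a rectangular band, or the laws of [x - y + z].

    The abelian representations over a binary generator are not quotients of [A]. They are built on
    terms, so one must first extract from [A] which data two equal terms share: end variables,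
    multiplicities modulo [p], or coefficients modulo an ideal.

    In the affine case [A] has no addition, only [k (1 - k) (u + v)] relative to a chosen origin.
    Hence sums are lists compared after scaling. Weak abelianness needs three equal entries, so
    these sums need not be cancellative, and passing to differences might collapse everything. The
    core is that it does not: [mu + w = w] forces [mu = 0]. *)

(* Let [phi] be a nontrivial weakly abelian representation on [A]. The elements
   that [phi] sends to projections form a proper subclone, so they are
   projections: every absorption identity of [A] holds in the clone.

   In the idempotent case weak abelianness makes every binary operation entropic.
   A binary nonprojection satisfying [x(xy) = x] generates a [p]-cyclic groupoid,
   one satisfying [x(yx) = x] a rectangular band. Otherwise fix a nonprojection
   [xy] and read it as [(1 - X) x + X y]. The differences between the coefficients
   of two terms that are equal in the clone span an ideal of Z[X]; weak abelianness
   and the absence of the two absorption identities make it proper, and minimality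
   makes [X] and [1 - X] invertible modulo it. Reducing modulo a prime and taking a
   root in a finite field gives a representation by affine operations, whose image
   contains [x - y + z]; by minimality this operation generates [xy], so the root
   lies in the prime field.

   If all binary operations are projections, weak abelianness leaves only a ternary
   minority operation, which is [x + y + z] on any two-element subset. *)

Lemma classicP (P : Prop) : P \/ ~ P.
Proof. by case: (pselect P); [left | right]. Qed.

Lemma ord2P (P : 'I_2 -> Prop) : P ord0 -> P ord_max -> forall i, P i.
Proof.
move=> P0 P1 i; have [e|e] : i = ord0 \/ i = ord_max; last 2 first.
- by rewrite e.
- by rewrite e.
by case: i => [[|[|k]] // H]; [left | right]; apply: val_inj.
Qed.

Lemma ord2_or (i : 'I_2) : i = ord0 \/ i = ord_max.
Proof. by move: i; apply: ord2P; [left | right]. Qed.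

Definition ord31 : 'I_3 := lift ord0 ord0.

Lemma ord3P (P : 'I_3 -> Prop) :
  P ord0 -> P ord31 -> P ord_max -> forall i, P i.
Proof.
move=> P0 P1 P2 i; have [e|[e|e]] :
  i = ord0 \/ (i = ord31 \/ i = ord_max); last 3 first.
- by rewrite e.
- by rewrite e.
- by rewrite e.
by case: i => [[|[|[|k]]] // H]; [left | right; left | right; right];
  apply: val_inj.
Qed.

Definition pr2 (A : Type) (x y : A) : 'I_2 -> A :=
  fun i => if i == ord0 then x else y.

Definition pr3 (A : Type) (x y z : A) : 'I_3 -> A :=
  fun i => if i == ord0 then x else if i == ord_max then z else y.

Lemma comp_pr2 (A B : Type) (h : A -> B) x y :
  (fun i => h (pr2 x y i)) = pr2 (h x) (h y).
Proof. by apply: funext; apply: ord2P. Qed.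

Lemma comp_pr3 (A B : Type) (h : A -> B) x y z :
  (fun i => h (pr3 x y z i)) = pr3 (h x) (h y) (h z).
Proof. by apply: funext; apply: ord3P. Qed.

Lemma pr2_eta (A : Type) (x : 'I_2 -> A) : x = pr2 (x ord0) (x ord_max).
Proof. by apply: funext; apply: ord2P. Qed.

Lemma pr3_eta (A : Type) (x : 'I_3 -> A) :
  x = pr3 (x ord0) (x ord31) (x ord_max).
Proof. by apply: funext; apply: ord3P. Qed.

(** * Terms over a binary operation *)

Inductive tree (X : Type) := Lf of X | Nd of tree X & tree X.

Fixpoint ev (X A : Type) (mul : A -> A -> A) (env : X -> A) (t : tree X) : A :=
  match t with
  | Lf x => env x
  | Nd t1 t2 => mul (ev mul env t1) (ev mul env t2)
  end.

Fixpoint lvar (X : Type) (t : tree X) : X :=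
  match t with Lf x => x | Nd t1 _ => lvar t1 end.

Fixpoint rvar (X : Type) (t : tree X) : X :=
  match t with Lf x => x | Nd _ t2 => rvar t2 end.

Lemma ev_subst (X Y A : Type) (mul : A -> A -> A) (env : Y -> A)
    (s : X -> tree Y) (t : tree X) :
  ev mul env (ev (@Nd Y) s t) = ev mul (fun x => ev mul env (s x)) t.
Proof. by elim: t => //= t1 -> t2 ->. Qed.

Lemma ev_morph (X A B : Type) (mA : A -> A -> A) (mB : B -> B -> B) (h : A -> B)
    (env : X -> A) (t : tree X) :
  (forall x y, h (mA x y) = mB (h x) (h y)) ->
  h (ev mA env t) = ev mB (fun x => h (env x)) t.
Proof. by move=> hM; elim: t => //= t1 <- t2 <-. Qed.

Lemma eq_ev (X A : Type) (mul mul' : A -> A -> A) (env env' : X -> A) t :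
  (forall x y, mul x y = mul' x y) -> (forall x, env x = env' x) ->
  ev mul env t = ev mul' env' t.
Proof. by move=> eM ee; elim: t => //= t1 -> t2 ->. Qed.

(** * Minimal clones: induction over subclones and generation by one operation *)

Section Clones.
Variable C : abs_clone.

Definition cmul (f : C 1%N) n (a b : C n) : C n := ccomp f (pr2 a b).

Definition evC (f : C 1%N) n (t : tree 'I_n.+1) : C n :=
  ev (cmul f (n := n)) (fun i => cproj i) t.

Lemma ccomp_cmul (f : C 1%N) n m (a b : C n) (g : 'I_n.+1 -> C m) :
  ccomp (cmul f a b) g = cmul f (ccomp a g) (ccomp b g).
Proof. by rewrite /cmul ccompA (comp_pr2 (fun a => ccomp a g)). Qed.

Lemma ccomp_evC (f : C 1%N) n m (t : tree 'I_n.+1) (g : 'I_n.+1 -> C m) :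
  ccomp (evC f t) g = ev (cmul f (n := m)) g t.
Proof.
rewrite /evC (ev_morph (mB := cmul f (n := m)) (h := fun a => ccomp a g));
  last by move=> x y; rewrite ccomp_cmul.
by apply: eq_ev => // x; rewrite ccomp_projl.
Qed.

Lemma evC_subst (f : C 1%N) n m (t : tree 'I_n.+1)
    (s : 'I_n.+1 -> tree 'I_m.+1) :
  evC f (ev (@Nd _) s t) = ccomp (evC f t) (fun i => evC f (s i)).
Proof. by rewrite ccomp_evC /evC ev_subst. Qed.

Lemma cmul_proj (f : C 1%N) : cmul f (cproj ord0) (cproj ord_max) = f.
Proof.
rewrite /cmul -[RHS]ccomp_projr; congr ccomp.
by apply: funext; apply: ord2P.
Qed.

Section Trees.
Variable f : C 1%N.

Let tree_mem n (g : C n) : Prop := exists t, g = evC f t.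

Fact tree_mem_proj n (i : 'I_n.+1) : tree_mem (cproj i).
Proof. by exists (Lf i). Qed.

Fact tree_mem_comp n m (h : C n) (g : 'I_n.+1 -> C m) :
  tree_mem h -> (forall i, tree_mem (g i)) -> tree_mem (ccomp h g).
Proof.
move=> [t ->] /choice[s es]; exists (ev (@Nd _) s t); rewrite evC_subst.
by congr ccomp; apply: funext => i; rewrite es.
Qed.

Definition tree_sub : subclone C := Subclone tree_mem_proj tree_mem_comp.

End Trees.

Hypothesis hmin : clone_minimal C.

Lemma min_ind (S : subclone C) n (g : C n) :
  S n g -> ~ is_proj g -> forall m (h : C m), S m h.
Proof. by move=> Sg ng m h; case: hmin => _ /(_ S) [|/(_ _ _ Sg)]. Qed.

Lemma min_tree (f : C 1%N) : ~ is_proj f ->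
  forall n (g : C n), exists t, g = evC f t.
Proof.
move=> nf; apply: (min_ind (S := tree_sub f)) nf.
by exists (Nd (Lf ord0) (Lf ord_max)); rewrite -[LHS]cmul_proj.
Qed.

End Clones.

(** * Representations and the lifting of absorption identities *)

Section Representations.
Variables (C : abs_clone) (A : Type) (phi : representation C A).

Definition bop (f : C 1%N) (x y : A) : A := phi _ f (pr2 x y).

Lemma phi_comp n m (f : C n) (g : 'I_n.+1 -> C m) x :
  phi _ (ccomp f g) x = phi _ f (fun i => phi _ (g i) x).
Proof. by rewrite hom_comp. Qed.

Lemma phi_proj n (i : 'I_n.+1) x : phi _ (cproj i) x = x i.
Proof. by rewrite hom_proj. Qed.

Lemma phi_cmul f n (a b : C n) x :
  phi _ (cmul f a b) x = bop f (phi _ a x) (phi _ b x).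
Proof. by rewrite /cmul phi_comp (comp_pr2 (fun a => phi _ a x)). Qed.

Lemma phi_evC f n (t : tree 'I_n.+1) x :
  phi _ (evC f t) x = ev (bop f) x t.
Proof.
rewrite /evC (ev_morph (mB := bop f) (h := fun a => phi n a x)).
  by apply: eq_ev => // i; rewrite phi_proj.
by move=> a b; rewrite phi_cmul.
Qed.

Lemma alg_trivialP :
  alg_trivial (rep_alg phi) <->
  forall n (g : C n), exists i, forall x, phi _ g x = x i.
Proof.
split=> [triv n g | triv n [g tg]].
  have tg : term_ops (rep_alg phi) n (phi n g).
    by apply: Gen_base; apply: (Basic_op (A := rep_alg phi) (existT _ n g)).
  have [i] := triv n (exist _ _ tg) => /(congr1 sval) /= e.
  by exists i => x; rewrite e.
have [i gi] : is_proj (C := op_clone A) g.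
  elim: tg => {n g} [n _ [[m g]] | n i | n m f g _ [i ->] _ pg] /=.
  - by have [i gi] := triv m g; exists i; apply: funext => x; rewrite gi.
  - by exists i.
  - by have [j gj] := pg i; exists j; apply: funext => x; rewrite [LHS]/= gj.
by exists i; apply: sop_inj.
Qed.

Hypotheses (hmin : clone_minimal C) (hnt : ~ alg_trivial (rep_alg phi)).

Lemma two_elements : exists a b : A, a <> b.
Proof.
apply: contrapT => ne; apply: hnt; apply/alg_trivialP => n g.
exists ord0 => x; apply: contrapT => nx; apply: ne.
by exists (phi n g x), (x ord0).
Qed.

Let proj_mem n (g : C n) : Prop := exists i, forall x, phi _ g x = x i.

Fact proj_mem_proj n (i : 'I_n.+1) : proj_mem (cproj i).
Proof. by exists i => x; rewrite phi_proj. Qed.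

Fact proj_mem_comp n m (h : C n) (g : 'I_n.+1 -> C m) :
  proj_mem h -> (forall i, proj_mem (g i)) -> proj_mem (ccomp h g).
Proof.
move=> [i hi] pg; have [j gj] := pg i; exists j => x.
by rewrite phi_comp hi gj.
Qed.

Definition proj_sub : subclone C := Subclone proj_mem_proj proj_mem_comp.

Lemma env_inj n (i j : 'I_n) : (forall x : 'I_n -> A, x i = x j) -> i = j.
Proof.
move=> e; have [a [b nab]] := two_elements.
apply/eqP/negPn/negP => nij; apply: nab.
by have := e (fun k => if k == i then a else b); rewrite eqxx eq_sym (negPf nij).
Qed.

(* The elements of [C] that [phi] sends to projections form a subclone, which
   cannot be all of [C]. *)
Lemma absorb n (g : C n) i : (forall x, phi _ g x = x i) -> g = cproj i.
Proof.
move=> gi; have [[j gj]|ng] := classicP (is_proj g).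
  suff -> : i = j by [].
  by apply: env_inj => x; rewrite -gi gj phi_proj.
case: hnt; apply/alg_trivialP.
by apply: (min_ind hmin (S := proj_sub)) ng; exists i.
Qed.

Lemma nproj2 (f : C 1%N) :
  ~ is_proj f <-> ~ (forall x y, bop f x y = x) /\ ~ (forall x y, bop f x y = y).
Proof.
split=> [nf|[n0 n1] [i]].
  split=> e; apply: nf; [exists ord0 | exists ord_max]; apply: absorb => x;
    by rewrite (pr2_eta x); apply: e.
move: i; apply: ord2P => ef; [apply: n0 | apply: n1] => x y;
  by rewrite /bop ef phi_proj.
Qed.

Lemma rep_tree (f : C 1%N) n (g : C n) : ~ is_proj f ->
  exists t, forall x, phi _ g x = ev (bop f) x t.
Proof.
by move=> nf; have [t ->] := min_tree hmin nf g; exists t => x; rewrite phi_evC.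
Qed.

Lemma rep_tree2 (f g : C 1%N) : ~ is_proj f ->
  exists t, forall x y, bop g x y = ev (bop f) (pr2 x y) t.
Proof.
by move=> nf; have [t et] := rep_tree g nf; exists t => x y; apply: et.
Qed.

End Representations.

Section Transfer.
Variables (C : abs_clone) (f : C 1%N) (B : Type) (mul : B -> B -> B).
Hypothesis ftree : forall n (g : C n), exists t, g = evC f t.
Hypothesis ev_eq : forall n (t t' : tree 'I_n.+1), evC f t = evC f t' ->
  forall x, ev mul x t = ev mul x t'.

(** Each element of [C] is evaluated through a chosen tree; [ev_eq] makes the choice immaterial,
    which gives compatibility with composition. *)
Lemma transfer : exists psi : representation C B,
  forall n (t : tree 'I_n.+1) x, psi _ (evC f t) x = ev mul x t.
Proof.
pose T n (g : C n) := projT1 (cid (ftree g)).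
have TE n (g : C n) : g = evC f (T n g) by apply: (projT2 (cid (ftree g))).
pose psi n (g : C n) : op_clone B n := fun x => ev mul x (T n g).
have psi_proj n (i : 'I_n.+1) : psi n (cproj i) = cproj i.
  by apply: funext => x; apply: (ev_eq (t' := Lf i)); rewrite -TE.
have psi_comp n m (h : C n) (g : 'I_n.+1 -> C m) :
    psi m (ccomp h g) = ccomp (psi n h) (fun i => psi m (g i)).
  apply: funext => x.
  rewrite [LHS](ev_eq (t' := ev (@Nd _) (fun i => T m (g i)) (T n h))).
    by rewrite ev_subst.
  rewrite -TE evC_subst -TE; congr ccomp.
  by apply: funext => i; rewrite -TE.
exists (CloneHom psi_proj psi_comp) => n t x /=.
by apply: ev_eq; rewrite -TE.
Qed.

End Transfer.

(** * Weak abelianness and entropicity *)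

Section WeaklyAbelian.
Variables (C : abs_clone) (A : Type) (phi : representation C A).

(* The polynomials in three row variables followed by three column
   variables. *)
Definition pol (t : A -> A -> A -> A -> A -> A -> A) : Prop :=
  exists t' : op A (2 + 3), poly_ops (rep_alg phi) _ t' /\
    forall r0 r1 r2 c0 c1 c2,
      t r0 r1 r2 c0 c1 c2 = t' (vcat (pr3 r0 r1 r2) (pr3 c0 c1 c2)).

Lemma vcatl n m (x : 'I_n -> A) (y : 'I_m -> A) i :
  vcat x y (lshift m i) = x i.
Proof. by rewrite /vcat (unsplitK (inl _ i)). Qed.

Lemma vcatr n m (x : 'I_n -> A) (y : 'I_m -> A) i :
  vcat x y (rshift n i) = y i.
Proof. by rewrite /vcat (unsplitK (inr _ i)). Qed.

Lemma pol_row i : pol (fun r0 r1 r2 _ _ _ => pr3 r0 r1 r2 i).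
Proof.
exists (fun x => x (lshift 3 i)); split; first exact: Gen_proj.
by move=> *; rewrite vcatl.
Qed.

Lemma pol_col i : pol (fun _ _ _ c0 c1 c2 => pr3 c0 c1 c2 i).
Proof.
exists (fun x => x (rshift 3 i)); split; first exact: Gen_proj.
by move=> *; rewrite vcatr.
Qed.

Lemma pol_const e : pol (fun _ _ _ _ _ _ => e).
Proof.
exists (fun=> e); split=> //; apply: Gen_base.
exact: (Basic_const (A := rep_alg phi)).
Qed.

Lemma pol_op n (g : C n) (t : 'I_n.+1 -> _) : (forall i, pol (t i)) ->
  pol (fun r0 r1 r2 c0 c1 c2 => phi _ g (fun i => t i r0 r1 r2 c0 c1 c2)).
Proof.
move=> /choice[t' tt]; exists (fun x => phi n g (fun i => t' i x)); split.
  apply: (Gen_comp (C := op_clone A) (f := phi n g)); last by move=> i; case: (tt i).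
  apply: Gen_base.
  exact: (Basic_symb (A := rep_alg phi) (existT _ n g)).
move=> *; congr (phi n g _); apply: funext => i.
by case: (tt i) => _ ->.
Qed.

Lemma pol_bop f s t : pol s -> pol t ->
  pol (fun r0 r1 r2 c0 c1 c2 =>
    bop phi f (s r0 r1 r2 c0 c1 c2) (t r0 r1 r2 c0 c1 c2)).
Proof.
move=> ps pt; have := @pol_op _ f (pr2 s t).
move=> /(_ (ord2P (P := fun i => pol (pr2 s t i)) ps pt)).
congr pol; do 6!apply: funext => ?.
by congr (phi _ f _); rewrite (comp_pr2 (fun u => u _ _ _ _ _ _)).
Qed.

Lemma pol_r0 : pol (fun r0 _ _ _ _ _ => r0). Proof. exact: (pol_row ord0). Qed.
Lemma pol_r1 : pol (fun _ r1 _ _ _ _ => r1). Proof. exact: (pol_row ord31). Qed.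
Lemma pol_r2 : pol (fun _ _ r2 _ _ _ => r2). Proof. exact: (pol_row ord_max). Qed.
Lemma pol_c0 : pol (fun _ _ _ c0 _ _ => c0). Proof. exact: (pol_col ord0). Qed.
Lemma pol_c1 : pol (fun _ _ _ _ c1 _ => c1). Proof. exact: (pol_col ord31). Qed.

Lemma wa_pol (hwa : weakly_abelian (rep_alg phi)) t
    a0 a1 a2 b0 b1 b2 c0 c1 c2 d0 d1 d2 u v : pol t ->
  t a0 a1 a2 c0 c1 c2 = u -> t a0 a1 a2 d0 d1 d2 = u ->
  t b0 b1 b2 c0 c1 c2 = u -> t b0 b1 b2 d0 d1 d2 = v -> u = v.
Proof.
move=> [t' [pt' tt']] e1 e2 e3 e4; apply: hwa.
exists 2, 2, t', (pr3 a0 a1 a2), (pr3 b0 b1 b2), (pr3 c0 c1 c2),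
  (pr3 d0 d1 d2); split=> //.
by split; rewrite -tt'.
Qed.

End WeaklyAbelian.

Ltac polyn :=
  repeat (first [apply: pol_r0 | apply: pol_r1 | apply: pol_r2 | apply: pol_c0
    | apply: pol_c1 | apply: pol_const | apply: pol_bop]).

Section Entropy.
Variables (C : abs_clone) (A : Type) (phi : representation C A).
Hypothesis hwa : weakly_abelian (rep_alg phi).

Lemma wa3 t (a b c d : A * A * A) u v : pol phi t ->
  t a.1.1 a.1.2 a.2 c.1.1 c.1.2 c.2 = u ->
  t a.1.1 a.1.2 a.2 d.1.1 d.1.2 d.2 = u ->
  t b.1.1 b.1.2 b.2 c.1.1 c.1.2 c.2 = u ->
  t b.1.1 b.1.2 b.2 d.1.1 d.1.2 d.2 = v -> u = v.
Proof. exact: wa_pol. Qed.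

Definition opp (f : C 1%N) : C 1%N := cmul f (cproj ord_max) (cproj ord0).

Lemma bop_opp f x y : bop phi (opp f) x y = bop phi f y x.
Proof. by rewrite /bop phi_cmul !phi_proj. Qed.

Hypothesis hid : forall (f : C 1%N) x, bop phi f x x = x.

Section OneOp.
Variable f : C 1%N.
Local Notation "x ** y" := (bop phi f x y) (at level 40, left associativity).
Let id x : x ** x = x := hid f x.

(** The multiplication table of [w] and [v] is the forbidden matrix. *)
Lemma wa_absorb w v : w ** v = w -> v ** w = w -> w = v.
Proof.
move=> wv vw; apply: (@wa3 (fun r _ _ c _ _ => r ** c)
  (w, w, w) (v, v, v) (w, w, w) (v, v, v)) => /=; rewrite ?id //.
by polyn.
Qed.

(** The columns exchange [q] and [r] in [(x ** q) ** (r ** s)], which the first row does not notice.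
    The extra factor [k] is, in the second row, the common value itself, so idempotence settles the
    third corner. The distributive laws and entropicity use the same device. *)
Lemma flex_half x y : x ** y ** x = x ** (y ** x) ** (x ** y ** x).
Proof.
apply: (@wa3 (fun s k _ q r _ => (x ** q) ** (r ** s) ** k)
  (y, x, x) (x, x ** y ** x, x) (y, x, x) (x, y, x)) => /=; rewrite ?id //.
by polyn.
Qed.

End OneOp.

(** Call the sides [P] and [Q]. The previous lemma gives [P = Q ** P], and for the opposite
    operation it gives [Q = Q ** P]. *)
Lemma flex f x y :
  bop phi f (bop phi f x y) x = bop phi f x (bop phi f y x).
Proof.
by have := flex_half (opp f) x y; rewrite !bop_opp -flex_half.
Qed.

Section LeftDist.
Variable f : C 1%N.
Local Notation "x ** y" := (bop phi f x y) (at level 40, left associativity).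
Let id x : x ** x = x := hid f x.

(** This is right distributivity with third factor [x ** y], needed as a corner in the proof of left
    distributivity. *)
Lemma mul_dist_self x y : (x ** (x ** y)) ** (y ** (x ** y)) = x ** y.
Proof.
set w := LHS; apply: (@wa_absorb f).
  symmetry; apply: (@wa3 (fun r k _ c d _ => k ** ((r ** c) ** (y ** d)))
    (y, x ** (x ** y), x) (x, w, x) (x ** y, x ** y, x) (x, y, x)) => /=;
    rewrite ?id ?flex //.
  by polyn.
symmetry; apply: (@wa3 (fun r k _ c d _ => (x ** c) ** (r ** d) ** k)
  (x, y ** (x ** y), x) (y, w, x) (x ** y, x ** y, x) (x, y, x)) => /=;
  rewrite ?id //.
by polyn.
Qed.

Lemma ldist x y z : x ** (y ** z) = (x ** y) ** (x ** z).
Proof.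
set u := LHS; set u' := RHS.
have -> : u' = u ** u'.
  apply: (@wa3 (fun s k _ q r _ => (x ** q) ** (r ** s) ** k)
    (y, x ** z, x) (z, u', x) (y, x, x) (x, y, x)) => /=; rewrite ?id //.
  by polyn.
apply: (@wa3 (fun p r k q s _ => k ** ((p ** q) ** (r ** s)))
  (y, z, x) (x, x, u) (y ** z, y ** z, x) (y, z, x)) => /=;
  rewrite ?id ?mul_dist_self //.
by polyn.
Qed.

End LeftDist.

Variable f : C 1%N.
Local Notation "x ** y" := (bop phi f x y) (at level 40, left associativity).
Let id x : x ** x = x := hid f x.

Lemma rdist x y z : (y ** z) ** x = (y ** x) ** (z ** x).
Proof. by have := ldist (opp f) x z y; rewrite !bop_opp. Qed.

(** In both matrices distributivity makes the first row constantly [m'], and the factor [k = m']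
    settles the third corner; so [m'] absorbs [m] on both sides. *)
Lemma entropic x y z u : (x ** y) ** (z ** u) = (x ** z) ** (y ** u).
Proof.
set m := LHS; set m' := RHS; apply/esym/(@wa_absorb f).
  symmetry; apply: (@wa3 (fun p k _ q r _ => k ** ((p ** q) ** (r ** u)))
    (z, x ** (y ** u), x) (x, m', x) (z, y, x) (y, z, x)) => /=;
    rewrite ?id //; first (by polyn); by rewrite -?ldist -rdist.
symmetry; apply: (@wa3 (fun s k _ q r _ => (x ** q) ** (r ** s) ** k)
  (y, x ** z ** u, x) (u, m', x) (z, y, x) (y, z, x)) => /=;
  rewrite ?id //; first (by polyn); by rewrite -?rdist -ldist.
Qed.

(** The row [(v, v)] has constant value [v] by the hypothesis, and the corner with [t(y, y)] equals
    [s(x, y) = v] by idempotence. *)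
Lemma absorb_right (s t : C 1%N) :
  (forall x y, bop phi s x (bop phi t x y) = x) ->
  forall x y z, bop phi s x (bop phi t y z) = bop phi s x y.
Proof.
move=> st x y z; set v := bop phi s x y; symmetry.
apply: (@wa3 (fun p q _ c _ _ => bop phi s p (bop phi t q c))
  (v, v, x) (x, y, x) (y, y, y) (z, z, z)) => //=; first by polyn.
by rewrite hid.
Qed.

End Entropy.

Lemma bij_choice (T U : Type) (h : T -> U) :
  injective h -> (forall u, exists t, h t = u) -> bijective h.
Proof.
move=> hI hS; pose g u := projT1 (cid (hS u)).
have gK u : h (g u) = u := projT2 (cid (hS u)).
by exists g => // t; apply: hI; rewrite gK.
Qed.

(* Since [vcat b d = vcat b c - vcat a c + vcat a d], it is enough that the
   polynomials commute with [x - y + z]. *)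
Lemma affine_abelian (C : abs_clone) (B : zmodType) (psi : representation C B) :
  (forall n (g : C n) (x y z : 'I_n.+1 -> B),
    psi _ g (fun i => x i - y i + z i)%R = (psi _ g x - psi _ g y + psi _ g z)%R) ->
  abelian_alg (rep_alg psi).
Proof.
move=> aff u v w [n [m [t [a [b [c [d [pt [e1 e2 e3 e4]]]]]]]]].
have taff x y z : t (fun i => x i - y i + z i)%R = (t x - t y + t z)%R.
  elim: {e1 e2 e3 e4} pt x y z =>
    {n m t a b c d} [n _ [[k g]|k e]|n i|n m g h _ IHg _ IHh] x y z //=.
    by rewrite subrr add0r.
  by rewrite -IHg; congr (g _); apply: funext => i; rewrite IHh.
have e : vcat b d = (fun i => vcat b c i - vcat a c i + vcat a d i)%R.
  apply: funext => i; rewrite /vcat; case: (split i) => j.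
    by rewrite subrK.
  by rewrite subrr add0r.
by rewrite e4 e taff -e1 -e2 -e3 subrK.
Qed.

Section Iso.
Variables (C : abs_clone) (A : Type) (phi : representation C A).
Hypotheses (hmin : clone_minimal C) (hnt : ~ alg_trivial (rep_alg phi)).
Variable f : C 1%N.
Hypothesis nf : ~ is_proj f.

Lemma groupoid_nontrivial : ~ alg_trivial (groupoid_alg (bop phi f)).
Proof.
move=> triv; have tf : term_ops (groupoid_alg (bop phi f)) 1 (phi _ f).
  have -> : phi _ f = @basic (groupoid_alg (bop phi f)) tt.
    by apply: funext => x; rewrite [in LHS](pr2_eta x).
  by apply: Gen_base; apply: (Basic_op (A := groupoid_alg (bop phi f)) tt).
have [i] := triv _ (exist _ _ tf) => /(congr1 sval) /= e.
by apply: nf; exists i; apply: (absorb hmin hnt) => x; rewrite e.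
Qed.

Lemma phi_term_op n (g : C n) : term_ops (groupoid_alg (bop phi f)) n (phi _ g).
Proof.
have [t et] := rep_tree phi hmin g nf.
have -> : phi _ g = (fun x => ev (bop phi f) x t) by apply: funext.
elim: t {et} => [i|t1 h1 t2 h2] /=; first exact: Gen_proj.
have -> : (fun x => bop phi f (ev (bop phi f) x t1) (ev (bop phi f) x t2)) =
  ccomp (a := op_clone A) (@basic (groupoid_alg (bop phi f)) tt)
    (pr2 (fun x => ev (bop phi f) x t1) (fun x => ev (bop phi f) x t2)).
  by apply: funext.
apply: Gen_comp; last exact: ord2P.
by apply: Gen_base; apply: (Basic_op (A := groupoid_alg (bop phi f)) tt).
Qed.

Lemma term_op_phi n t : term_ops (groupoid_alg (bop phi f)) n t ->
  exists g : C n, phi _ g = t.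
Proof.
elim=> {n t} [n _ [[]]|n i|n m h g _ [h' <-] _ /choice[g' eg]].
- by exists f; apply: funext => x; rewrite [in LHS](pr2_eta x).
- by exists (cproj i); rewrite hom_proj.
exists (ccomp h' g'); rewrite hom_comp; congr ccomp.
by apply: funext => i; rewrite eg.
Qed.

Lemma groupoid_iso :
  (forall n (g h : C n), (forall x, phi _ g x = phi _ h x) -> g = h) ->
  clone_iso C (term_clone (groupoid_alg (bop phi f))).
Proof.
move=> inj; pose psi n (g : C n) : term_clone (groupoid_alg (bop phi f)) n :=
  exist _ (phi _ g) (phi_term_op g).
have psi_proj n (i : 'I_n.+1) : psi n (cproj i) = cproj i.
  by apply: sop_inj; rewrite /= hom_proj.
have psi_comp n m (h : C n) (g : 'I_n.+1 -> C m) :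
    psi m (ccomp h g) = ccomp (psi n h) (fun i => psi m (g i)).
  by apply: sop_inj; rewrite /= hom_comp.
exists (CloneHom psi_proj psi_comp) => n; apply: bij_choice => /=.
  by move=> g h /(congr1 sval) /= e; apply: inj => x; rewrite e.
move=> [t tt]; have [g eg] := term_op_phi tt.
by exists g; apply: (@sop_inj _ (term_ops (groupoid_alg (bop phi f)))) => /=.
Qed.

End Iso.

(* If, for the variable [i], the map [z |-> h (x, .., z, .., x)] has finite
   order on [A], this order is an absorption identity, hence [h] is
   determined by [phi h]. *)
Section FiniteOrderInjective.
Variables (C : abs_clone) (A : Type) (phi : representation C A).
Hypotheses (hmin : clone_minimal C) (hnt : ~ alg_trivial (rep_alg phi)).

Definition upd (X : eqType) (B : Type) (x : X -> B) (i : X) (z : B) : X -> B :=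
  fun j => if j == i then z else x j.

Definition subst_at n (h : C n) (i : 'I_n.+1) (z : C n) : C n :=
  ccomp h (upd (fun j => cproj j) i z).

Lemma phi_subst_at n (h : C n) i z x :
  phi _ (subst_at h i z) x = phi _ h (upd x i (phi _ z x)).
Proof.
rewrite /subst_at phi_comp; congr (phi _ h _); apply: funext => j.
by rewrite /upd; case: ifP; rewrite // phi_proj.
Qed.

Lemma subst_at_proj n (h : C n) i : subst_at h i (cproj i) = h.
Proof.
rewrite -[RHS]ccomp_projr; congr ccomp; apply: funext => j.
by rewrite /upd; case: eqP => // ->.
Qed.

Lemma iter_subst_at k n (h : C n) i z :
  ccomp (iter k (subst_at h i) (cproj i)) (upd (fun j => cproj j) i z) =
  iter k (subst_at h i) z.
Proof.
elim: k => [|k IHk] /=; first by rewrite ccomp_projl /upd eqxx.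
rewrite {1}/subst_at ccompA; congr ccomp; apply: funext => j.
rewrite {1 3}/upd; case: eqP => [_|/eqP/negPf nji]; first by rewrite IHk.
by rewrite ccomp_projl /upd nji.
Qed.

Lemma finite_order_inj n (h h' : C n) k i :
  (forall x, phi _ (iter k.+1 (subst_at h i) (cproj i)) x = x i) ->
  (forall x, phi _ h x = phi _ h' x) -> h = h'.
Proof.
move=> /(absorb hmin hnt) hk e.
have hK z : iter k.+1 (subst_at h i) z = z.
  by rewrite -iter_subst_at hk ccomp_projl /upd eqxx.
have phi_iter j z z' : (forall x, phi _ z x = phi _ z' x) ->
    forall x, phi _ (iter j (subst_at h i) z) x =
              phi _ (iter j (subst_at h i) z') x.
  by move=> ez; elim: j => //= j IHj x; rewrite !phi_subst_at IHj.
have ek : iter k (subst_at h i) h' = cproj i.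
  apply: (absorb hmin hnt) => x; rewrite -(phi_iter k h) //.
  by rewrite -{2}(subst_at_proj h i) -iterSr hk phi_proj.
by have := hK h'; rewrite iterS ek subst_at_proj.
Qed.

End FiniteOrderInjective.

(** * Rectangular bands *)

Section BinaryCases.
Variables (C : abs_clone) (A : Type) (phi : representation C A).
Hypotheses (hmin : clone_minimal C) (hnt : ~ alg_trivial (rep_alg phi)).
Hypothesis hwa : weakly_abelian (rep_alg phi).
Hypothesis hid : forall (f : C 1%N) x, bop phi f x x = x.

Lemma affine_bop_abelian_rep (f : C 1%N) (B : zmodType) (mul : B -> B -> B) :
  ~ is_proj f ->
  (forall x y z x' y' z' : B, mul (x - y + z) (x' - y' + z') =
     mul x x' - mul y y' + mul z z')%R ->
  (exists x y, mul x y <> x) -> (exists x y, mul x y <> y) ->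
  (forall n (t t' : tree 'I_n.+1), evC f t = evC f t' ->
    forall x, ev mul x t = ev mul x t') ->
  exists (A : Type) (phi : representation C A),
    ~ alg_trivial (rep_alg phi) /\ abelian_alg (rep_alg phi).
Proof.
move=> nf aff n0 n1 /(transfer (fun n (g : C n) => min_tree hmin nf g))[psi ep].
exists B, psi; split; last first.
  apply: affine_abelian => n g x y z; have [t ->] := min_tree hmin nf g.
  by rewrite !ep; elim: t => //= t1 -> t2 ->; rewrite aff.
move/alg_trivialP => /(_ _ (evC (n := 1) f (Nd (Lf ord0) (Lf ord_max))))[i ei].
have {}ei x y : mul x y = pr2 x y i by rewrite -ei ep.
move: i ei; apply: (@ord2P (fun i => _ -> False)) => ei;
  by [case: n0 => x [y]; apply | case: n1 => x [y]; apply].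
Qed.

Section RectangularBand.
Variable f : C 1%N.
Local Notation "x ** y" := (bop phi f x y) (at level 40, left associativity).
Hypotheses (nf : ~ is_proj f) (fR : forall x y, x ** (y ** x) = x).

(** An element is recovered from one right and one left product, so equalities can be tested on
    these. *)
Lemma rect_decomp x z t : t = (t ** x) ** (z ** t).
Proof.
have flx := flex hwa hid f.
by rewrite (ldist hwa hid) flx fR (rdist hwa hid) flx !fR.
Qed.

Lemma rect_mul3 x y z : x ** y ** z = x ** z.
Proof.
have flx := flex hwa hid f.
have e := rect_decomp x z.
rewrite (e (x ** y ** z)); congr (_ ** _); last by rewrite fR.
by rewrite (rdist hwa hid) flx fR fR.
Qed.

Lemma rect_mul3' x y z : x ** (y ** z) = x ** z.
Proof.
have flx := flex hwa hid f.
have e := rect_decomp x z.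
rewrite (e (x ** (y ** z))) flx fR; congr (_ ** _).
by rewrite (ldist hwa hid) fR flx fR.
Qed.

Lemma rect_ev (X : Type) (x : X -> A) t :
  ev (bop phi f) x t = x (lvar t) ** x (rvar t).
Proof.
by elim: t => /= [i|t1 -> t2 ->]; rewrite ?(hid f) // rect_mul3 rect_mul3'.
Qed.

Lemma rect_mul_neq : (exists a b c, a ** c <> b ** c) /\
  (exists a b c, c ** a <> c ** b).
Proof.
have [n0 n1] := (nproj2 hmin hnt f).1 nf.
split; apply: contrapT => e.
  apply: n1 => x y; apply: contrapT => ne; apply: e.
  by exists x, y, y; rewrite (hid f).
apply: n0 => x y; apply: contrapT => ne; apply: e.
by exists y, x, x; rewrite (hid f).
Qed.

Lemma rect_vars n (t t' : tree 'I_n.+1) : evC f t = evC f t' ->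
  lvar t = lvar t' /\ rvar t = rvar t'.
Proof.
move=> e; have {}e x : x (lvar t) ** x (rvar t) = x (lvar t') ** x (rvar t').
  by rewrite -!rect_ev -!phi_evC e.
have [[a [b [c nl]]] [a' [b' [c' nr]]]] := rect_mul_neq.
split; apply/eqP/negPn/negP => nij.
  apply: nl; have := e (upd (fun=> b) (lvar t) a) => /(congr1 (fun u => u ** c)).
  by rewrite !rect_mul3 /upd eqxx eq_sym (negPf nij).
apply: nr; have := e (upd (fun=> b') (rvar t) a') => /(congr1 (fun u => c' ** u)).
by rewrite !rect_mul3' /upd eqxx eq_sym (negPf nij).
Qed.

(* [g = (g x_i)(x_j g)], where both factors are absorption identities. *)
Lemma rect_inj n (g h : C n) : (forall x, phi _ g x = phi _ h x) -> g = h.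
Proof.
have [t et] := rep_tree phi hmin g nf => e.
suff normal k : (forall x, phi _ k x = x (lvar t) ** x (rvar t)) ->
    k = cmul f (cproj (lvar t)) (cproj (rvar t)).
  rewrite (normal g) => [|x]; last by rewrite et rect_ev.
  by rewrite (normal h) // => x; rewrite -e et rect_ev.
move=> ek; have kl : cmul f k (cproj (lvar t)) = cproj (lvar t).
  apply: (absorb hmin hnt) => x; rewrite phi_cmul phi_proj ek.
  by rewrite rect_mul3 (hid f).
have kr : cmul f (cproj (rvar t)) k = cproj (rvar t).
  apply: (absorb hmin hnt) => x; rewrite phi_cmul phi_proj ek.
  by rewrite rect_mul3' (hid f).
have kk : cmul f (cmul f (cproj ord0) (cproj ord_max))
    (cmul f (cproj ord31) (cproj ord0)) = cproj ord0 :> C 2%N.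
  apply: (absorb hmin hnt) => x; rewrite !phi_cmul !phi_proj.
  by rewrite rect_mul3 rect_mul3' (hid f).
have := congr1 (fun u => ccomp u (pr3 k (cproj (rvar t)) (cproj (lvar t)))) kk.
by rewrite /= !ccomp_cmul !ccomp_projl /= kl kr.
Qed.

Lemma rectangular_band_case :
  (exists (A : Type) (phi : representation C A),
    ~ alg_trivial (rep_alg phi) /\ abelian_alg (rep_alg phi)) /\
  exists (G : Type) (mul : G -> G -> G),
        [/\ rectangular_band mul, ~ alg_trivial (groupoid_alg mul)
          & clone_iso C (term_clone (groupoid_alg mul))].
Proof.
split; last first.
  exists A, (bop phi f); split.
  - split=> [x y z|x|x y z]; rewrite ?rect_mul3 ?rect_mul3' //.
  - exact: (groupoid_nontrivial hmin hnt nf).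
  exact: (groupoid_iso hmin nf rect_inj).
(* The free choice of end variables: a term takes its first coordinate from the leftmost variable
   and its second from the rightmost, and by [rect_vars] equal elements of [C] share both. *)
pose mul (x y : int * int) := (x.1, y.2).
have ev_mul (X : Type) (x : X -> int * int) t :
  ev mul x t = ((x (lvar t)).1, (x (rvar t)).2).
  elim: t => [i|t1 e1 t2 e2] /=; first by case: (x i).
  by rewrite e1 e2.
apply: (affine_bop_abelian_rep (mul := mul) nf) => //.
- by exists (0, 0)%R, (0, 1)%R.
- by exists (1, 0)%R, (0, 0)%R.
by move=> n t t' /rect_vars[el er] x; rewrite !ev_mul el er.
Qed.

End RectangularBand.
End BinaryCases.

(** * Cyclic groupoids *)

Section LeftNormal.
Variables (B : Type) (mul : B -> B -> B).
Local Notation "x ** y" := (mul x y) (at level 40, left associativity).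
Hypothesis mulxx : forall x, x ** x = x.
Hypothesis mulA : forall x y z, x ** (y ** z) = x ** y.
Hypothesis mulAC : forall x y z, x ** y ** z = x ** z ** y.

Definition rpow k x y := iter k (fun z => z ** y) x.

Lemma rpowD k l x y : rpow (k + l) x y = rpow k (rpow l x y) y.
Proof. by rewrite /rpow iterD. Qed.

Lemma rpowM k l x y : rpow (k * l) x y = iter k (fun z => rpow l z y) x.
Proof. by elim: k => //= k <-; rewrite mulSn rpowD. Qed.

Lemma rpow_xx k x : rpow k x x = x.
Proof. by elim: k => //= k ->. Qed.

Lemma mul_rpow x k y z : x ** rpow k y z = x ** y.
Proof. by elim: k => //= k <-; rewrite mulA. Qed.

Lemma mul_ev (X : Type) u (x : X -> B) t : u ** ev mul x t = u ** x (lvar t).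
Proof. by elim: t => //= t1 <- t2 _; rewrite mulA. Qed.

Lemma rpow_mul k x y z : rpow k (x ** z) y = rpow k x y ** z.
Proof. by elim: k => //= k ->; rewrite mulAC. Qed.

Lemma rpow_rpow k l x y z : rpow k (rpow l x z) y = rpow l (rpow k x y) z.
Proof. by elim: l => //= l <-; rewrite rpow_mul. Qed.

(* The value of [t] is the leftmost variable acted upon by the list [nf t]. *)
Fixpoint nf (X : eqType) (t : tree X) : seq X :=
  match t with
  | Lf _ => [::]
  | Nd t1 t2 => if lvar t2 == lvar t1 then nf t1 else rcons (nf t1) (lvar t2)
  end.

Lemma lvar_nf (X : eqType) (t : tree X) : lvar t \notin nf t.
Proof.
elim: t => //= t1 IH t2 _; case: eqP => // /eqP ne.
by rewrite mem_rcons in_cons negb_or IH andbT eq_sym.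
Qed.

Lemma foldl_mul x s z : foldl mul (x ** z) s = foldl mul x s ** z.
Proof. by elim: s x => //= y s IH x; rewrite -IH mulAC. Qed.

Lemma ev_nf (X : eqType) (x : X -> B) t :
  ev mul x t = foldl mul (x (lvar t)) (map x (nf t)).
Proof.
elim: t => //= t1 IH t2 _; rewrite mul_ev IH.
case: eqP => [->|_]; first by rewrite -foldl_mul mulxx.
by rewrite map_rcons foldl_rcons.
Qed.

Lemma foldl_rpow k x y s :
  foldl mul (rpow k x y) s = rpow k (foldl mul x s) y.
Proof. by elim: k => //= k <-; rewrite foldl_mul. Qed.

Lemma foldl_order p x s : (forall x y, rpow p x y = x) ->
  iter p (fun z => foldl mul z s) x = x.
Proof.
move=> hp; elim: s x => [|y s IH] x /=; first by elim: p {hp}.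
suff -> : forall k, iter k (fun z => foldl mul (z ** y) s) x =
    rpow k (iter k (fun z => foldl mul z s) x) y by rewrite IH hp.
elim=> [|k IHk] //; rewrite iterS IHk foldl_mul foldl_rpow.
by rewrite /rpow iterS.
Qed.

Lemma foldl_upd (X : eqType) j (a b : B) (s : seq X) :
  foldl mul a (map (upd (fun=> a) j b) s) = rpow (count_mem j s) a b.
Proof.
elim/last_ind: s => [|s k IH] //.
rewrite map_rcons foldl_rcons IH -cats1 count_cat /= addn0.
rewrite /upd; case: eqP => _; first by rewrite addn1.
by rewrite addn0 -rpow_mul mulxx.
Qed.

End LeftNormal.

Section Cyclic.
Variables (C : abs_clone) (A : Type) (phi : representation C A).
Hypotheses (hmin : clone_minimal C) (hnt : ~ alg_trivial (rep_alg phi)).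
Hypothesis hwa : weakly_abelian (rep_alg phi).
Hypothesis hid : forall (f : C 1%N) x, bop phi f x x = x.

Section CyclicGroupoid.
Variables (p : nat) (f : C 1%N).
Hypotheses (pp : prime p) (cyc : cyclic_groupoid p (bop phi f)).
Hypothesis npf : ~ is_proj f.
Local Notation "x ** y" := (bop phi f x y) (at level 40, left associativity).
Local Notation rp := (rpow (bop phi f)).

Let mxx x : x ** x = x. Proof. by case: cyc. Qed.
Let mA x y z : x ** (y ** z) = x ** y. Proof. by case: cyc. Qed.
Let mAC x y z : x ** y ** z = x ** z ** y. Proof. by case: cyc. Qed.
Let rpp x y : rp p x y = x. Proof. by case: cyc => _ _ _; apply. Qed.

(** As a function of its leftmost variable, [g] is a composite of commuting right translations of
    order dividing [p]. That variable does not occur in [nf t], so iterating the substitution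
    iterates this composite. *)
Lemma cyclic_inj n (g h : C n) : (forall x, phi _ g x = phi _ h x) -> g = h.
Proof.
have [t et] := rep_tree phi hmin g npf.
apply: (finite_order_inj hmin hnt (k := p.-1) (i := lvar t)).
move=> x; rewrite prednK ?prime_gt0 //.
rewrite -[RHS](foldl_order mAC (x (lvar t)) (map x (nf t)) rpp).
elim: (p) => [|k IHk]; first by rewrite /= phi_proj.
rewrite !iterS phi_subst_at IHk et (ev_nf mxx mA mAC) /upd eqxx.
congr foldl; apply/eq_in_map => j jt.
by case: eqP jt => // ->; rewrite (negPf (lvar_nf _)).
Qed.

Let rpM k x y : rp (k * p) x y = x.
Proof. by rewrite rpowM; elim: k => //= k ->. Qed.

(** The number [d] stands for [k - l] modulo [p] without subtraction, and [rp d] fixes its first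
    argument. Were [d] prime to [p], a Bezout relation would give [x ** y = x]. *)
Lemma cyclic_rpow_inj k l : (forall x y, rp k x y = rp l x y) -> k = l %[mod p].
Proof.
have [n0 _] := (nproj2 hmin hnt f).1 npf.
move=> e; pose d := l * p.-1 + k.
have ld : l * p = l * p.-1 + l by rewrite -{1}(prednK (prime_gt0 pp)) mulnS addnC.
have rd x y : rp d x y = x by rewrite rpowD e -rpowD -ld rpM.
suff /dvdnP[m dm] : p %| d.
  by rewrite -(modnMDl l) ld addnAC -/d dm modnMDl.
apply/negPn/negP => ndvd; have d0 : 0 < d.
  by rewrite lt0n; apply: contraNneq ndvd => ->; rewrite dvdn0.
have /(coprimeP _ d0)[[u v] /= uv] : coprime d p.
  by rewrite coprime_sym prime_coprime.
apply: n0 => x y; have : rp (u * d) x y = x.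
  by rewrite rpowM; elim: (u) => //= m ->.
have -> : u * d = 1 + v * p by lia.
by rewrite rpowD rpM.
Qed.

(** A left factor [a] forgets all but the leftmost variable of a term. Giving one variable the value
    [b] and all others the value [a] isolates its multiplicity. *)
Lemma cyclic_vars n (t t' : tree 'I_n.+1) : evC f t = evC f t' ->
  lvar t = lvar t' /\
  forall j, count_mem j (nf t) = count_mem j (nf t') %[mod p].
Proof.
have [n0 _] := (nproj2 hmin hnt f).1 npf.
move=> e; have {}e x : ev (bop phi f) x t = ev (bop phi f) x t'.
  by rewrite -!phi_evC e.
have el : lvar t = lvar t'.
  apply/eqP/negPn/negP => nij; apply: n0 => a b.
  have := e (upd (fun=> b) (lvar t) a) => /(congr1 (fun u => a ** u)).
  by rewrite !(mul_ev mA) /upd eqxx eq_sym (negPf nij) mxx.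
split=> // j; have [->|nj] := eqVneq j (lvar t).
  by rewrite (count_memPn (lvar_nf t)) el (count_memPn (lvar_nf t')).
apply: cyclic_rpow_inj => a b; have := e (upd (fun=> a) j b).
rewrite !(ev_nf mxx mA mAC) -el {1 3}/upd eq_sym (negPf nj).
by rewrite !(foldl_upd mxx mAC).
Qed.

Local Open Scope ring_scope.

Lemma cyclic_abelian_rep_char (K : fieldType) : p%:R = 0 :> K ->
  exists (A : Type) (phi : representation C A),
    ~ alg_trivial (rep_alg phi) /\ abelian_alg (rep_alg phi).
Proof.
move=> pK.
(* Right translation by [y] adds [y.2 - x.2] to the first coordinate, so [p] of them cancel in
   characteristic [p], and a term depends only on its leftmost variable and on multiplicities modulo
   [p]. *)
pose mul (x y : K * K) := (x.1 + (y.2 - x.2), x.2)%R.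
have bxx x : mul x x = x by case: x => x y; rewrite /mul subrr addr0.
have bA x y z : mul x (mul y z) = mul x y by [].
have bAC x y z : mul (mul x y) z = mul (mul x z) y.
  by rewrite /mul /= addrAC.
have fE x (s : seq (K * K)) : foldl mul x s =
    (x.1 + \sum_(y <- s) (y.2 - x.2), x.2)%R.
  elim/last_ind: s => [|s y IH]; first by rewrite big_nil addr0; case: x.
  by rewrite foldl_rcons IH /mul /= -cats1 big_cat big_seq1 /= -addrA.
apply: (affine_bop_abelian_rep (mul := mul) hmin npf).
- by move=> x y z x' y' z'; apply: injective_projections; rewrite /mul /=; ring.
- by exists (0, 0)%R, (0, 1)%R => /(congr1 fst)/eqP; rewrite /mul /= subr0 add0r oner_eq0.
- by exists (0, 0)%R, (0, 1)%R => /(congr1 snd)/eqP; rewrite /mul /= eq_sym oner_eq0.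
move=> n t t' /cyclic_vars[el ec] x.
rewrite !(ev_nf bxx bA bAC) -el !fE; congr (_ + _, _)%R.
have cnt s (F : 'I_n.+1 -> K) :
    (\sum_(i <- s) F i = \sum_i F i * (count_mem i s %% p)%:R)%R.
  have natK m : (m %% p)%:R = m%:R :> K.
    by rewrite [in RHS](divn_eq m p) natrD natrM pK mulr0 add0r.
  under [RHS]eq_bigr do rewrite natK.
  elim: s => [|k s IH]; first by rewrite big_nil big1 // => i _; rewrite mulr0.
  rewrite big_cons IH (bigD1 k) //= [in RHS](bigD1 k) //= eqxx natrD mulrDr mulr1.
  rewrite -addrA; congr (_ + (_ + _))%R; apply: eq_bigr => i /negPf.
  by rewrite eq_sym => ->.
rewrite !big_map.
rewrite (cnt (nf t) (fun i => (x i).2 - (x (lvar t)).2)).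
rewrite (cnt (nf t') (fun i => (x i).2 - (x (lvar t)).2)).
by apply: eq_bigr => i _; rewrite ec.
Qed.

Lemma cyclic_abelian_rep : exists (A : Type) (phi : representation C A),
    ~ alg_trivial (rep_alg phi) /\ abelian_alg (rep_alg phi).
Proof.
apply: (@cyclic_abelian_rep_char 'F_p).
exact: (pcharf0 (pchar_Fp pp)).
Qed.

End CyclicGroupoid.
End Cyclic.

(** * From the law [x(xy) = x] to a [p]-cyclic groupoid *)

Section CyclicCase.
Variables (C : abs_clone) (A : Type) (phi : representation C A).
Hypotheses (hmin : clone_minimal C) (hnt : ~ alg_trivial (rep_alg phi)).
Hypothesis hwa : weakly_abelian (rep_alg phi).
Hypothesis hid : forall (f : C 1%N) x, bop phi f x x = x.
Variable f : C 1%N.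
Local Notation "x ** y" := (bop phi f x y) (at level 40, left associativity).
Local Notation rp := (rpow (bop phi f)).
Hypotheses (npf : ~ is_proj f) (fN : forall x y, x ** (x ** y) = x).

Let mxx x : x ** x = x := hid f x.

Lemma abs_mulA x y z : x ** (y ** z) = x ** y.
Proof. exact: (absorb_right hwa hid (s := f) (t := f) fN). Qed.

Lemma abs_mulAC x y z : x ** y ** z = x ** z ** y.
Proof.
by rewrite -[in LHS](abs_mulA _ z y) (entropic hwa hid) mxx.
Qed.

Definition crpow k : C 1%N :=
  iter k (fun z => cmul f z (cproj ord_max)) (cproj ord0).

Lemma bop_crpow k x y : bop phi (crpow k) x y = rp k x y.
Proof.
elim: k => [|k IH]; first by rewrite /bop phi_proj.
by rewrite /bop phi_cmul phi_proj -/(bop phi (crpow k) x y) IH.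
Qed.

Lemma crpow_proj k : is_proj (crpow k) -> forall x y, rp k x y = x.
Proof.
have [n0 _] := (nproj2 hmin hnt f).1 npf.
move=> [i ei]; have {}ei x y : rp k x y = pr2 x y i.
  by rewrite -bop_crpow ei /bop phi_proj.
move: i ei; apply: ord2P => ei x y; first exact: ei.
case: n0 => {}x {}y; have := mul_rpow abs_mulA x k x y.
by rewrite ei mxx.
Qed.

Lemma pol_rp k t : pol phi t ->
  pol phi (fun r0 r1 r2 c0 c1 c2 => rp k (t r0 r1 r2 c0 c1 c2) c0).
Proof. by move=> pt; elim: k => //= k IH; apply: pol_bop => //; polyn. Qed.

Lemma rp_xx k x : rp k x x = x. Proof. exact: rpow_xx. Qed.

Lemma rp_A k x y z : rp k x (rp k y z) = rp k x y.
Proof.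
rewrite {1 3}/rpow; congr (iter k _ x); apply: funext => u.
by rewrite mul_rpow //; exact: abs_mulA.
Qed.

Lemma rp_AC k x y z : rp k (rp k x y) z = rp k (rp k x z) y.
Proof. exact: (rpow_rpow abs_mulAC). Qed.

Lemma rp_ev0 k (t : tree 'I_2) : lvar t = ord0 ->
  exists e, forall x y, ev (rp k) (pr2 x y) t = rp (e * k) x y.
Proof.
move=> lt; exists (count_mem ord_max (nf t)) => x y.
have -> : pr2 x y = upd (fun=> x) ord_max y.
  by apply: funext; apply: ord2P.
rewrite (ev_nf (rp_xx k) (rp_A k) (rp_AC k)) lt.
by rewrite (foldl_upd (rp_xx k) (rp_AC k)) rpowM.
Qed.

(** If the double translation is not a projection, minimality writes [x ** y] as a term over it. A
    leftmost [y] would turn [fN] into [x ** y = x], so the term is [rp (e * 2) x y]. With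
    [e * 2 = N.+2], the element [w] is fixed by [N.+1] more translations by [y], and weak
    abelianness cancels these to [w = x]. *)
Lemma rp_order : exists2 N, 0 < N & forall x y, rp N x y = x.
Proof.
have [n0 n1] := (nproj2 hmin hnt f).1 npf.
have [/crpow_proj e|n2] := classicP (is_proj (crpow 2)); first by exists 2.
have [t et] := rep_tree2 phi hmin f n2.
have {}et x y : x ** y = ev (rp 2) (pr2 x y) t.
  by rewrite et; apply: eq_ev => // u v; rewrite bop_crpow.
have mul_ev2 u x y : u ** ev (rp 2) (pr2 x y) t = u ** pr2 x y (lvar t).
  by elim: (t) => //= t1 <- t2 _; rewrite !abs_mulA.
have lt : lvar t = ord0.
  case/orP: (orbN (lvar t == ord0)) => [/eqP//|/negPf l0].
  case: n0 => x y; have := fN x y.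
  by rewrite [X in x ** X]et mul_ev2 /pr2 l0.
have [e {}et] : exists e, forall x y, x ** y = rp (e * 2) x y.
  by have [e ee] := rp_ev0 2 lt; exists e => x y; rewrite et ee.
have [N eN] : exists N, e * 2 = N.+2.
  case: e et => [e|e _]; first by case: n0 => x y; apply: e.
  by exists (e * 2).
rewrite eN in et; exists N.+1 => // x y; set w := rp N.+1 x y.
apply/(@wa3 _ _ phi hwa (fun r _ _ c _ _ => rp N.+1 r c)
  (w, w, w) (x, x, x) (y, y, y) (x, x, x)) => //=.
- exact: (pol_rp N.+1 (pol_r0 phi)).
- rewrite -[LHS]/(rp N.+1 w y) -[RHS]/(rp N.+1 x y) -rpowD addSnnS rpowD -et.
  by rewrite -(rpowD _ N 1) addn1.
- by rewrite -[LHS]/(rp N.+1 w x) rp_AC rpow_xx.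
by rewrite -[LHS]/(rp N.+1 x x) rpow_xx.
Qed.

(** For a prime [q] dividing the order [N], the power [N %/ q] either is a projection, so that [N]
    can be lowered, or is itself a [q]-cyclic operation. *)
Lemma cyclic_generator : exists p g,
  [/\ prime p, cyclic_groupoid p (bop phi g) & ~ is_proj g].
Proof.
have [n0 _] := (nproj2 hmin hnt f).1 npf.
have [N N0 hN] := rp_order; elim/ltn_ind: N N0 hN => N IH N0 hN.
have N1 : 1 < N.
  by case: N N0 hN {IH} => [|[]] // _ h; case: n0 => x y; apply: h.
set q := pdiv N; have qN : q %| N := pdiv_dvd N.
have qp : prime q by apply: pdiv_prime.
set m := N %/ q; have mN : m * q = N := divnK qN.
have [/crpow_proj hm|nm] := classicP (is_proj (crpow m)).
  apply: (IH m) => //; first by rewrite ltn_Pdiv ?prime_gt1.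
  by rewrite divn_gt0 ?prime_gt0 // dvdn_leq.
exists q, (crpow m); split=> //.
have -> : bop phi (crpow m) = rp m.
  by apply: funext => x; apply: funext => y; rewrite bop_crpow.
split=> [||x y z|x y]; [exact: rp_xx | exact: rp_A | exact: rp_AC |].
by rewrite -[LHS](rpowM _ q m) mulnC mN.
Qed.

Lemma cyclic_case :
  (exists (A : Type) (phi : representation C A),
    ~ alg_trivial (rep_alg phi) /\ abelian_alg (rep_alg phi)) /\
  exists (p : nat) (G : Type) (mul : G -> G -> G),
        [/\ prime p, cyclic_groupoid p mul \/ cyclic_groupoid p (dual mul),
            ~ alg_trivial (groupoid_alg mul)
          & clone_iso C (term_clone (groupoid_alg mul))].
Proof.
have [p [g [pp gp ng]]] := cyclic_generator.
split; first exact: (cyclic_abelian_rep hmin hnt pp gp ng).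
exists p, A, (bop phi g); split=> //; first by left.
  exact: (groupoid_nontrivial hmin hnt ng).
apply: (groupoid_iso hmin ng); exact: (cyclic_inj hmin hnt pp gp ng).
Qed.

End CyclicCase.

(** * The coefficient ideal of an affine-like operation *)

Section NonZeroDivisors.
Variables (C : abs_clone) (A : Type) (phi : representation C A).
Hypotheses (hmin : clone_minimal C) (hnt : ~ alg_trivial (rep_alg phi)).
Hypothesis hwa : weakly_abelian (rep_alg phi).
Hypothesis hid : forall (f : C 1%N) x, bop phi f x x = x.
Hypothesis hN : forall f : C 1, ~ is_proj f ->
  ~ forall x y, bop phi f x (bop phi f x y) = x.
Hypothesis hR : forall f : C 1, ~ is_proj f ->
  ~ forall x y, bop phi f x (bop phi f y x) = x.

Lemma bop_proj0 x y : bop phi (cproj ord0) x y = x.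
Proof. by rewrite /bop phi_proj. Qed.

Lemma bop_proj1 x y : bop phi (cproj ord_max) x y = y.
Proof. by rewrite /bop phi_proj. Qed.

Lemma is_proj2 (g : C 1) : is_proj g -> g = cproj ord0 \/ g = cproj ord_max.
Proof.
by move=> [i ->]; move: i; apply: ord2P; [left | right].
Qed.

(** Coefficients have no zero divisors. If neither operation is a projection, [absorb_right] gives
    [s(x, t(y, z)) = s(x, y)]. As [s] is a term over [t], the value [s(u, s(x, y))] depends on [u]
    and one of [x], [y] only, and putting [u] equal to it gives one of the two excluded laws. *)
Lemma nzd (s t : C 1) : (forall o y, bop phi s o (bop phi t o y) = o) ->
  (forall o y, bop phi s o y = o) \/ (forall o y, bop phi t o y = o).
Proof.
move=> st; have [/is_proj2[->|et]|nt] := classicP (is_proj t).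
- by right=> o y; rewrite bop_proj0.
- by left=> o y; have := st o y; rewrite et bop_proj1.
have [/is_proj2[->|es]|ns] := classicP (is_proj s).
- by left=> o y; rewrite bop_proj0.
- by right=> o y; have := st o y; rewrite es bop_proj1.
have stA := absorb_right hwa hid st.
have [T eT] := rep_tree2 phi hmin s nt.
have sT u x y : bop phi s u (bop phi s x y) = bop phi s u (pr2 x y (lvar T)).
  by rewrite (eT x y); elim: (T) => //= t1 IH t2 _; rewrite stA IH.
have [el|el] := ord2_or (lvar T).
  by case: (hN ns) => x y; rewrite sT el hid.
by case: (hR ns) => x y; rewrite sT el hid.
Qed.

End NonZeroDivisors.

(* In the affine operation [x ** y = (1 - k) x + k y] with origin [o], [ad u v]
   is [k (1 - k) (u + v)], [sg u] is [k (1 - k) u], and [vsum K l] is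
   [(k (1 - k)) ^ K] times the sum of [l] as soon as [size l <= K]. *)
Section ScaledSums.
Variables (A : Type) (mul : A -> A -> A).
Local Notation "x ** y" := (mul x y) (at level 40, left associativity).
Hypothesis mulxx : forall x, x ** x = x.
Hypothesis mulACA : forall x y z u, (x ** y) ** (z ** u) = (x ** z) ** (y ** u).
Variable o : A.

Definition sg u := o ** (u ** o).
Definition ad u v := (o ** u) ** (v ** o).

Fixpoint vsum K (l : seq A) : A :=
  match K, l with
  | K'.+1, u :: l' => ad (iter K' sg u) (vsum K' l')
  | _, _ => o
  end.

Lemma ad_o u : ad u o = sg u.
Proof. by rewrite /ad /sg mulACA mulxx. Qed.

Lemma adC u v : ad u v = ad v u.
Proof. by rewrite /ad mulACA. Qed.

Lemma o_ad u : ad o u = sg u.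
Proof. by rewrite adC ad_o. Qed.

Lemma sg_o : sg o = o.
Proof. by rewrite /sg !mulxx. Qed.

Lemma ad_mul a b c d : ad (a ** b) (c ** d) = ad a c ** ad b d.
Proof.
rewrite /ad -{1 2}[o]mulxx (mulACA o o a b) (mulACA c d o o).
by rewrite mulACA.
Qed.

Lemma sg_mul a b : sg (a ** b) = sg a ** sg b.
Proof. by rewrite -!ad_o -{1}[o]mulxx ad_mul. Qed.

Lemma adACA a b c d : ad (ad a b) (ad c d) = ad (ad a c) (ad b d).
Proof.
have oo : ad o o = o by rewrite ad_o sg_o.
transitivity (ad ((o ** a) ** (b ** o)) ((o ** c) ** (d ** o))); first by [].
by rewrite (ad_mul (o ** a)) (ad_mul o a o c) (ad_mul b o d o) oo.
Qed.

Lemma sg_ad a b : sg (ad a b) = ad (sg a) (sg b).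
Proof. by rewrite -!ad_o -{1}sg_o -ad_o adACA. Qed.

Lemma vsum_nil K : vsum K [::] = o.
Proof. by case: K. Qed.

Lemma vsumS K l : size l <= K -> vsum K.+1 l = sg (vsum K l).
Proof.
elim: K l => [|K IH] [|u l] //= lK; rewrite ?sg_o //.
by rewrite sg_ad -IH.
Qed.

Lemma vsum_addn J K l : size l <= K -> vsum (J + K) l = iter J sg (vsum K l).
Proof.
move=> lK; elim: J => // J IHJ; rewrite iterS -IHJ addSn vsumS //.
by rewrite (leq_trans lK) ?leq_addl.
Qed.

Lemma vsum1 K u : vsum K.+1 [:: u] = iter K.+1 sg u.
Proof. by rewrite /= -ad_o; case: K. Qed.

Lemma vsum_cat K l1 l2 : size l1 + size l2 <= K ->
  vsum K.+1 (l1 ++ l2) = ad (vsum K l1) (vsum K l2).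
Proof.
elim: l1 K => [|u l1 IH] K.
  by move=> lK; rewrite vsum_nil o_ad cat0s vsumS.
case: K => // K; rewrite /= addSn ltnS => lK.
rewrite -[LHS]/(ad (iter K.+1 sg u) (vsum K.+1 (l1 ++ l2))).
rewrite IH // -[iter K.+1 sg u]ad_o adACA o_ad -vsumS //.
by apply: leq_trans lK; rewrite leq_addl.
Qed.

Lemma vsum_map h K l : h o = o -> (forall a b, h (a ** b) = h a ** h b) ->
  h (vsum K l) = vsum K (map h l).
Proof.
move=> ho hM; have hsg u : h (sg u) = sg (h u) by rewrite /sg !hM ho.
elim: K l => [|K IH] [|u l] //=; rewrite /ad !hM ho IH; congr (_ ** _ ** _).
by elim: K {IH} => //= K <-.
Qed.

Lemma map_iter_sg J K l : vsum K (map (iter J sg) l) = iter J sg (vsum K l).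
Proof.
elim: J => [|J IH]; first by rewrite map_id.
rewrite iterS -IH (vsum_map (h := sg)) ?sg_o //; last exact: sg_mul.
by rewrite -map_comp.
Qed.

End ScaledSums.

(** * Formal sums and their differences *)

Section FormalSums.
Variables (C : abs_clone) (A : Type) (phi : representation C A).
Hypotheses (hmin : clone_minimal C) (hnt : ~ alg_trivial (rep_alg phi)).
Hypothesis hwa : weakly_abelian (rep_alg phi).
Hypothesis hid : forall (f : C 1%N) x, bop phi f x x = x.
Hypothesis hN : forall f : C 1, ~ is_proj f ->
  ~ forall x y, bop phi f x (bop phi f x y) = x.
Hypothesis hR : forall f : C 1, ~ is_proj f ->
  ~ forall x y, bop phi f x (bop phi f y x) = x.
Variable f : C 1.
Hypothesis npf : ~ is_proj f.

Local Notation mul := (bop phi f).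
Local Notation "x ** y" := (bop phi f x y) (at level 40, left associativity).
Local Notation one := (cproj ord_max : C 1).
Local Notation zero := (cproj ord0 : C 1).

Let mxx x : x ** x = x := hid f x.
Let mACA := entropic hwa hid f.

Definition valo o y (g : C 1) := bop phi g o y.
Local Notation vs o K y l := (vsum mul o K (map (valo o y) l)).

(* A list [l] stands for the sum of its elements, scaled by a power of
   [k (1 - k)]. *)
Definition eqv (l l' : seq (C 1)) := exists K, forall J, K <= J ->
  forall o y, vs o J y l = vs o J y l'.

Local Infix "~~" := eqv (at level 70, no associativity).

(** Beyond the lengths of the lists, raising the level only applies [sg], so a single level decides
    all higher ones. *)
Lemma eqv_at K l l' : size l <= K -> size l' <= K ->
  (forall o y, vs o K y l = vs o K y l') -> l ~~ l'.
Proof.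
move=> lK lK' e; exists K => J KJ o y.
by rewrite -(subnK KJ) !(vsum_addn mxx mACA) ?size_map // e.
Qed.

Lemma eqv_refl l : l ~~ l. Proof. by exists 0. Qed.

Lemma eqv_sym l l' : l ~~ l' -> l' ~~ l.
Proof. by move=> [K e]; exists K => J KJ o y; rewrite e. Qed.

Lemma eqv_trans l l' l'' : l ~~ l' -> l' ~~ l'' -> l ~~ l''.
Proof.
move=> [K e] [K' e']; exists (maxn K K') => J.
by rewrite geq_max => /andP[KJ KJ'] o y; rewrite e ?e'.
Qed.

Lemma eqv_cat l1 l2 l1' l2' : l1 ~~ l1' -> l2 ~~ l2' -> l1 ++ l2 ~~ l1' ++ l2'.
Proof.
move=> [K e] [K' e'].
exists (maxn (maxn K K') (size (l1 ++ l2) + size (l1' ++ l2'))).+1 => -[//|J].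
rewrite ltnS !geq_max !size_cat => /andP[/andP[KJ KJ'] sJ] o y.
rewrite !map_cat !(vsum_cat mxx mACA) ?size_map ?e ?e' //.
  by apply: leq_trans sJ; rewrite leq_addl.
by apply: leq_trans sJ; rewrite leq_addr.
Qed.

Lemma eqv_catC l1 l2 : l1 ++ l2 ~~ l2 ++ l1.
Proof.
apply: (@eqv_at (size l1 + size l2).+1) => [||o y].
- by rewrite size_cat leqnSn.
- by rewrite size_cat addnC leqnSn.
rewrite !map_cat !(vsum_cat mxx mACA) ?size_map ?(addnC (size l2)) //.
exact: (adC mACA).
Qed.

Lemma eqv_catl l l1 l2 : l1 ~~ l2 -> l ++ l1 ~~ l ++ l2.
Proof. by move=> e; apply: eqv_cat => //; apply: eqv_refl. Qed.

Lemma eqv_catr l l1 l2 : l1 ~~ l2 -> l1 ++ l ~~ l2 ++ l.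
Proof. by move=> e; apply: eqv_cat => //; apply: eqv_refl. Qed.

Lemma eqv_zero : [:: zero] ~~ [::].
Proof.
apply: (@eqv_at 1) => // o y.
by rewrite /= /valo bop_proj0 (ad_o mxx mACA) (sg_o mxx).
Qed.

Lemma bop_mulACA (g : C 1) x y z u :
  bop phi g (x ** y) (z ** u) = bop phi g x z ** bop phi g y u.
Proof.
have [t et] := rep_tree2 phi hmin g npf; rewrite !et.
by elim: t {et} => [i|t1 /= -> t2 ->]; [case: (ord2_or i) => -> | rewrite mACA].
Qed.

Definition act (g h : C 1) : C 1 := cmul g zero h.

Lemma valo_act g h o y : valo o y (act g h) = bop phi g o (valo o y h).
Proof. by rewrite /valo /bop phi_cmul phi_proj. Qed.

Lemma vs_act g o K y l :
  vs o K y (map (act g) l) = bop phi g o (vs o K y l).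
Proof.
rewrite (vsum_map (h := bop phi g o)) ?hid //; last first.
  by move=> a b; rewrite -bop_mulACA mxx.
congr vsum; rewrite -!map_comp; apply: eq_map => h.
exact: valo_act.
Qed.

Lemma eqv_act g l l' : l ~~ l' -> map (act g) l ~~ map (act g) l'.
Proof. by move=> [K e]; exists K => J KJ o y; rewrite !vs_act e. Qed.

Lemma eqv_actr h l l' : l ~~ l' -> map (act^~ h) l ~~ map (act^~ h) l'.
Proof.
move=> [K e]; exists K => J KJ o y; rewrite -!map_comp.
have vh g : (valo o y \o act^~ h) g = valo o (bop phi h o y) g.
  by rewrite /= valo_act.
by rewrite !(eq_map vh) e.
Qed.

Lemma bop_ad (g : C 1) o u v :
  sg mul o (bop phi g u v) = ad mul o (bop phi g u o) (bop phi g o v).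
Proof.
have e1 a b : o ** bop phi g a b = bop phi g (o ** a) (o ** b).
  by rewrite bop_mulACA hid.
have e2 a b : bop phi g a b ** o = bop phi g (a ** o) (b ** o).
  by rewrite bop_mulACA hid.
rewrite [RHS]/ad e1 e2 -bop_mulACA [LHS]/sg e2 e1.
congr (bop phi g _ _); first exact/esym/(ad_o mxx mACA o u).
exact/esym/(o_ad mxx mACA o v).
Qed.

Lemma eqv_act2 g u v : [:: cmul g u v] ~~ [:: cmul g u zero; cmul g zero v].
Proof.
apply: (@eqv_at 2) => // o y /=; rewrite !(ad_o mxx mACA) -!(sg_ad mxx mACA).
congr sg; rewrite /valo /bop !phi_cmul !phi_proj /= -/(bop phi u o y).
by rewrite -/(bop phi v o y) bop_ad.
Qed.

(** Since [ad] is the polynomial [(o ** r) ** (x ** o)], weak abelianness applies to concatenation.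
    It stands in for cancellation of sums. *)
Lemma eqv_wa a b c d u :
  a ++ c ~~ u -> a ++ d ~~ u -> b ++ c ~~ u -> b ++ d ~~ u.
Proof.
move=> [K1 e1] [K2 e2] [K3 e3].
exists (K1 + K2 + K3 + (size a + size b + size c + size d)).+1 => -[//|J].
rewrite ltnS => KJ o y.
have cat l1 l2 : size l1 + size l2 <= size a + size b + size c + size d ->
    vs o J.+1 y (l1 ++ l2) = ad mul o (vs o J y l1) (vs o J y l2).
  by move=> s12; rewrite map_cat (vsum_cat mxx mACA) ?size_map //; lia.
have {}e1 := e1 J.+1 ltac:(lia) o y; have {}e2 := e2 J.+1 ltac:(lia) o y.
have {}e3 := e3 J.+1 ltac:(lia) o y.
rewrite cat in e1; last lia; rewrite cat in e2; last lia.
rewrite cat in e3; last lia; rewrite cat; last lia.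
apply/esym/(@wa3 _ _ phi hwa (fun r _ _ x _ _ => (o ** r) ** (x ** o))
  (vs o J y a, o, o) (vs o J y b, o, o) (vs o J y c, o, o) (vs o J y d, o, o)).
- by polyn.
- exact: e1.
- exact: e2.
- exact: e3.
by [].
Qed.

Definition is_zero (g : C 1) := forall o y, bop phi g o y = o.

Definition sgC : C 1 := cmul f zero (cmul f one zero).

Lemma bop_sgC o u : bop phi sgC o u = sg mul o u.
Proof. by rewrite /bop !phi_cmul !phi_proj. Qed.

Lemma valo_iter_sgC K g o y :
  valo o y (iter K (act sgC) g) = iter K (sg mul o) (valo o y g).
Proof. by elim: K => //= K <-; rewrite valo_act bop_sgC. Qed.

(** The scalar [k (1 - k)] is not zero, since [sg mul o u = o] is the excluded law [x(yx) = x]; so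
    [nzd] removes it. *)
Lemma sgC_nzd K g : is_zero (iter K (act sgC) g) -> is_zero g.
Proof.
elim: K => //= K IH gz; apply: IH => o y.
have [] := nzd hmin hwa hid hN hR (s := sgC) (t := iter K (act sgC) g).
- by move=> o' y'; rewrite -[RHS](gz o' y') -!/(valo _ _ _) valo_act.
- by move=> z; case: (hR npf) => x {}y; rewrite -[RHS](z x y) bop_sgC.
by move=> ->.
Qed.

Lemma eqv_nil g : [:: g] ~~ [::] -> is_zero g.
Proof.
move=> [K e]; apply: (@sgC_nzd K.+1) => o y.
have := e K.+1 (leqnSn K) o y.
by rewrite [map _ _]/= (vsum1 mxx mACA) vsum_nil -valo_iter_sgC.
Qed.

Lemma one_nz : ~ is_zero one.
Proof.
have [n0 n1] := (nproj2 hmin hnt f).1 npf.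
by move=> z; apply: n0 => x y; have := z x (x ** y); rewrite bop_proj1.
Qed.

Lemma act_one g : act g one = g. Proof. exact: cmul_proj. Qed.

Lemma act1 g : act one g = g.
Proof. by rewrite /act /cmul ccomp_projl. Qed.

(** The complementary coefficient: one minus that of [g]. *)
Definition bar (g : C 1) : C 1 := cmul g one zero.

Lemma eqv_bar g : [:: bar g; g] ~~ [:: one].
Proof.
have e1 : cmul g one one = one.
  by apply: (absorb hmin hnt) => x; rewrite phi_cmul phi_proj hid.
by have := eqv_act2 g one one; rewrite e1 cmul_proj => /eqv_sym.
Qed.

Section Absorption.
Variable mu : C 1.
Hypotheses (mu1 : [:: one; mu] ~~ [:: one]).

Lemma bar_one : [:: bar mu] ~~ [:: one].
Proof.
have := @eqv_wa [:: one] [:: bar mu] [:: mu] [::] [:: one] mu1.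
by apply; [exact: eqv_refl | exact: eqv_bar].
Qed.

Lemma one_act w : [:: one; act mu w] ~~ [:: one].
Proof.
have e : [:: w; act mu w] ~~ [:: w].
  by have := eqv_actr w mu1; rewrite /= act1.
apply: eqv_trans (eqv_catr [:: act mu w] (eqv_sym (eqv_bar w))) _.
apply: eqv_trans (eqv_bar w).
exact: (eqv_catl [:: bar w] e).
Qed.

End Absorption.

(** Adding [bar w] reduces to [1 + mu = 1], which by weak abelianness also forces [bar mu] to be
    [1]. Then terms over [mu] composed with itself can be summed explicitly; minimality puts [mu]
    among them and yields an idempotent sum [u + u = u], whence [u = 0]. *)
Lemma no_absorption mu w : [:: mu; w] ~~ [:: w] -> is_zero mu.
Proof.
move=> muw; apply: contrapT => munz.
have mu1 : [:: one; mu] ~~ [:: one].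
  apply: eqv_trans (eqv_catr [:: mu] (eqv_sym (eqv_bar w))) _.
  apply: eqv_trans (eqv_bar w).
  apply: (eqv_catl [:: bar w]); apply: eqv_trans muw.
  exact: (eqv_catC [:: w] [:: mu]).
have double u : [:: u; u] ~~ [:: u] -> is_zero u.
  move=> uu; apply: eqv_nil; apply: eqv_sym.
  by apply: (@eqv_wa [:: u] [::] [:: u] [::] [:: u]); rewrite //; exact: eqv_refl.
(* The square is used because [mu + mu (mu v) = mu (1 + mu v) = mu], whereas [mu + mu v] is not
   controlled. *)
set ph := act mu mu.
have ph1 : [:: one; ph] ~~ [:: one] by apply: one_act.
have [/is_proj2[e|e]|nph] := classicP (is_proj ph).
- apply: munz; have mm o y : bop phi mu o (bop phi mu o y) = o.
    by rewrite -/(valo o y mu) -valo_act -/ph e /valo bop_proj0.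
  by have [] := nzd hmin hwa hid hN hR mm.
- by rewrite e in ph1; apply: one_nz; apply: double.
have ph_act v : act ph v = act mu (act mu v).
  by rewrite /ph /act {1}/cmul ccomp_cmul ccomp_projl.
have split u v : [:: cmul ph u v] ~~ [:: u; act ph v].
  apply: eqv_trans (eqv_act2 ph u v) _.
  apply: (@eqv_catr [:: act ph v] [:: cmul ph u zero] [:: u]).
  have := eqv_actr u (bar_one ph1); rewrite /= act1.
  by rewrite /act /bar {1}/cmul ccomp_cmul !ccomp_projl.
(* As [ph] acts by [(u, v) |-> u + ph v], a term is its leftmost variable plus multiples of [ph];
   these are absorbed by [mu] if that variable is the origin, and by [1] otherwise. *)
have tree_sum (t : tree 'I_2) : if lvar t == ord0
    then [:: mu; evC ph t] ~~ [:: mu] else [:: evC ph t] ~~ [:: one].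
  elim: t => [i|t1 IH t2 _].
    have [->|->] /= := ord2_or i; last exact: eqv_refl.
    exact: (eqv_catl [:: mu] eqv_zero).
  have st := split (evC ph t1) (evC ph t2); move: IH; rewrite /=.
  case: ifP => _ IH.
    apply: eqv_trans (eqv_catl [:: mu] st) _.
    apply: eqv_trans (eqv_catr [:: act ph (evC ph t2)] IH) _.
    have := eqv_act mu (one_act mu1 (evC ph t2)).
    by rewrite /= act_one -ph_act.
  apply: eqv_trans st _; apply: eqv_trans (one_act ph1 (evC ph t2)).
  exact: (eqv_catr [:: act ph (evC ph t2)] IH).
have [t et] := min_tree hmin nph mu; have := tree_sum t; rewrite -et.
case: ifP => _ e; first by apply: munz; apply: double.
apply: one_nz; apply: double; apply: eqv_trans mu1.
exact: (eqv_catl [:: one] (eqv_sym e)).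
Qed.

Lemma eqv_ext (F G : C 1 -> C 1) l :
  (forall h o y, valo o y (F h) = valo o y (G h)) -> map F l ~~ map G l.
Proof.
move=> e; exists 0 => J _ o y; rewrite -!map_comp; congr vsum.
by apply: eq_map => h; apply: e.
Qed.

Lemma eqv_catACA a b c d : (a ++ b) ++ (c ++ d) ~~ (a ++ c) ++ (b ++ d).
Proof.
rewrite -!catA; apply: eqv_catl; rewrite !catA.
exact/eqv_catr/eqv_catC.
Qed.

Lemma eqv_catAC a b c : (a ++ b) ++ c ~~ (a ++ c) ++ b.
Proof. by rewrite -!catA; apply/eqv_catl/eqv_catC. Qed.

Definition smul m (l : seq (C 1)) := iter m (map (act sgC)) l.

Lemma smul_cat m l l' : smul m (l ++ l') = smul m l ++ smul m l'.
Proof. by elim: m => //= m ->; rewrite map_cat. Qed.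

Lemma smulD m n l : smul (m + n) l = smul m (smul n l).
Proof. exact: iterD. Qed.

Lemma eqv_smul m l l' : l ~~ l' -> smul m l ~~ smul m l'.
Proof. by move=> e; elim: m => //= m; apply: eqv_act. Qed.

(* Equality in the group of differences, localized at [k (1 - k)]. *)
Definition geqv l l' := exists m k, smul m l ++ k ~~ smul m l' ++ k.

Lemma eqv_geqv l l' : l ~~ l' -> geqv l l'.
Proof. by move=> e; exists 0, [::]; rewrite !cats0. Qed.

Lemma geqv_refl l : geqv l l.
Proof. exact/eqv_geqv/eqv_refl. Qed.

Lemma geqv_sym l l' : geqv l l' -> geqv l' l.
Proof. by move=> [m [k e]]; exists m, k; apply: eqv_sym. Qed.

Lemma geqv_raise j m k l l' : smul m l ++ k ~~ smul m l' ++ k ->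
  smul (j + m) l ++ smul j k ~~ smul (j + m) l' ++ smul j k.
Proof. by move/(eqv_smul j); rewrite !smul_cat !smulD. Qed.

Lemma geqv_trans l l' l'' : geqv l l' -> geqv l' l'' -> geqv l l''.
Proof.
move=> [m [k e]] [n [k' e']]; have {}e := geqv_raise n e.
have {}e' := geqv_raise m e'; rewrite addnC in e'.
exists (n + m), (smul n k ++ smul m k'); rewrite !catA.
apply: eqv_trans (eqv_catr _ e) _; apply: eqv_trans (eqv_catAC _ _ _) _.
apply: eqv_trans (eqv_catr _ e') _; exact: eqv_catAC.
Qed.

Lemma geqv_cat l1 l2 l1' l2' :
  geqv l1 l1' -> geqv l2 l2' -> geqv (l1 ++ l2) (l1' ++ l2').
Proof.
move=> [m [k e]] [n [k' e']]; have {}e := geqv_raise n e.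
have {}e' := geqv_raise m e'; rewrite addnC in e'.
exists (n + m), (smul n k ++ smul m k'); rewrite !smul_cat.
apply: eqv_trans (eqv_catACA _ _ _ _) _.
by apply: eqv_trans (eqv_cat e e') _; apply: eqv_catACA.
Qed.

Lemma geqv_cancel k l l' : geqv (l ++ k) (l' ++ k) -> geqv l l'.
Proof.
by move=> [m [k' e]]; exists m, (smul m k ++ k'); rewrite !catA -!smul_cat.
Qed.

Lemma geqv_smul j l l' : geqv (smul j l) (smul j l') -> geqv l l'.
Proof. by move=> [m [k e]]; exists (m + j), k; rewrite !smulD. Qed.

Lemma smul_act m g l : smul m (map (act g) l) ~~ map (act g) (smul m l).
Proof.
elim: m => [|m IH]; first exact: eqv_refl.
apply: eqv_trans (eqv_act sgC IH) _; rewrite /= -!map_comp.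
apply: eqv_ext => h o y; rewrite /= !valo_act !bop_sgC /sg.
have gM a b : bop phi g o (a ** b) = bop phi g o a ** bop phi g o b.
  by rewrite -bop_mulACA mxx.
by rewrite !gM hid.
Qed.

Lemma geqv_act g l l' : geqv l l' -> geqv (map (act g) l) (map (act g) l').
Proof.
move=> [m [k e]]; exists m, (map (act g) k).
apply: eqv_trans (eqv_catr _ (smul_act _ _ _)) _.
apply: eqv_trans (eqv_catr _ (eqv_sym (smul_act _ _ _))).
by rewrite -!map_cat; apply: eqv_act.
Qed.

Lemma act_f_bar l : map (act f) (map (act (bar f)) l) ~~ smul 1 l.
Proof.
rewrite -map_comp; apply: eqv_ext => h o y /=.
by rewrite !valo_act bop_sgC /bar /sg {2}/bop !phi_cmul !phi_proj.
Qed.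

Lemma act_bar_f l : map (act (bar f)) (map (act f) l) ~~ smul 1 l.
Proof.
rewrite -map_comp; apply: eqv_ext => h o y /=.
rewrite !valo_act bop_sgC /bar /sg {1}/bop !phi_cmul !phi_proj.
exact: (flex hwa hid).
Qed.

Lemma act_bar_add l : map (act (bar f)) l ++ map (act f) l ~~ l.
Proof.
elim: l => [|h l IH]; first exact: eqv_refl.
apply: eqv_trans (eqv_catACA [:: act (bar f) h] _ [:: act f h] _) _.
apply: (@eqv_cat _ _ [:: h]) IH.
by have := eqv_actr h (eqv_bar f); rewrite /= act1.
Qed.

Local Open Scope ring_scope.

(** * Integer polynomials acting on differences *)

Definition mon i : C 1 := iter i (act f) one.

Definition psum (p : seq nat) : {poly int} := \sum_(i <- p) 'X^i.

Lemma psum_cat p q : psum (p ++ q) = psum p + psum q.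
Proof. exact: big_cat. Qed.

Lemma psum_cons i p : psum (i :: p) = 'X^i + psum p.
Proof. exact: big_cons. Qed.

Lemma psumX p : psum (map S p) = 'X * psum p.
Proof.
by rewrite /psum big_map mulr_sumr; apply: eq_bigr => i _; rewrite exprS.
Qed.

Lemma map_monS p : map mon (map S p) = map (act f) (map mon p).
Proof. by rewrite -!map_comp. Qed.

Lemma coef_psum p i : (psum p)`_i = (count_mem i p)%:R.
Proof.
elim: p => [|j p IH]; first by rewrite /psum big_nil coef0.
by rewrite psum_cons coefD IH coefXn /= natrD eq_sym.
Qed.

Lemma psum_inj p q : psum p = psum q -> perm_eq p q.
Proof.
move=> e; apply/allP => i _ /=; apply/eqP.
by have := congr1 (fun P : {poly int} => P`_i) e; rewrite !coef_psum !natz => -[].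
Qed.

Lemma eqv_flatten (F : nat -> seq (C 1)) p q : perm_eq p q ->
  flatten (map F p) ~~ flatten (map F q).
Proof.
elim: p q => [|i p IH] q.
  by rewrite perm_sym => /perm_nilP->; apply: eqv_refl.
move=> e; have iq : i \in q by rewrite -(perm_mem e) mem_head.
case/splitPr: iq e => q1 q2; rewrite -[i :: q2]cat1s perm_sym perm_catCA perm_sym.
rewrite /= perm_cons => /IH e; rewrite map_cat flatten_cat /=.
apply: eqv_trans (eqv_catl (F i) e) _; rewrite map_cat flatten_cat !catA.
exact/eqv_catr/eqv_catC.
Qed.

Lemma eqv_perm p q : perm_eq p q -> map mon p ~~ map mon q.
Proof.
have e r : map mon r = flatten (map (fun i => [:: mon i]) r).
  by elim: r => //= i r ->.
by rewrite !e; apply: eqv_flatten.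
Qed.

(** These are the polynomials that vanish when [X] acts as [f] on differences of sums. Lists can
    only be added, so [F] is split into two sums of monomials. Inverting [k (1 - k)] in [geqv] makes
    the ideal saturated for [X] and [1 - X]. *)
Definition ideal (F : {poly int}) : Prop :=
  exists p q, F = psum p - psum q /\ geqv (map mon p) (map mon q).

Lemma poly_psum (F : {poly int}) : exists p q, F = psum p - psum q.
Proof.
elim/poly_ind: F => [|F c [p [q ->]]]; first by exists [::], [::]; rewrite subrr.
have nat_psum n : psum (nseq n 0%N) = n%:R.
  elim: n => [|n IH]; first by rewrite /psum big_nil.
  by rewrite psum_cons IH expr0 [RHS]mulrS.
case: c => n.
  exists (map S p ++ nseq n 0%N), (map S q).
  rewrite psum_cat !psumX nat_psum mulrC mulrBr addrAC.
  by rewrite -[Posz n]natz rmorph_nat.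
exists (map S p), (map S q ++ nseq n.+1 0%N).
rewrite psum_cat !psumX nat_psum mulrC mulrBr opprD addrA.
by rewrite NegzE -natz rmorphN rmorph_nat.
Qed.

(** Two splittings of one polynomial become permutations of each other after cross-addition, because
    coefficients count multiplicities; the common part then cancels. *)
Lemma ideal_indep p q :
  ideal (psum p - psum q) -> geqv (map mon p) (map mon q).
Proof.
move=> [p' [q' [/eqP]]].
rewrite subr_eq addrAC eq_sym subr_eq -!psum_cat => /eqP/psum_inj.
rewrite perm_sym => /eqv_perm/eqv_geqv; rewrite !map_cat => e e'.
apply: (@geqv_cancel (map mon q')); apply: geqv_trans e _.
apply: geqv_trans (geqv_cat e' (geqv_refl _)) _.
exact/eqv_geqv/eqv_catC.
Qed.

Lemma ideal0 : ideal 0.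
Proof. by exists [::], [::]; rewrite subrr; split=> //; apply: geqv_refl. Qed.

Lemma idealD F G : ideal F -> ideal G -> ideal (F + G).
Proof.
move=> [p [q [-> e]]] [p' [q' [-> e']]]; exists (p ++ p'), (q ++ q').
rewrite !psum_cat opprD addrACA !map_cat; split=> //.
exact: geqv_cat.
Qed.

Lemma idealN F : ideal F -> ideal (- F).
Proof.
move=> [p [q [-> e]]]; exists q, p; rewrite opprB; split=> //.
exact: geqv_sym.
Qed.

Lemma idealM G F : ideal F -> ideal (G * F).
Proof.
move=> iF; elim/poly_ind: G => [|G c IH]; first by rewrite mul0r; apply: ideal0.
rewrite mulrDl; apply: idealD.
  rewrite -mulrA mulrCA; have [p [q [-> e]]] := IH.
  exists (map S p), (map S q); rewrite !psumX mulrBr !map_monS; split=> //.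
  exact: geqv_act.
have natM n : ideal (n%:R * F).
  elim: n => [|n IHn]; first by rewrite mul0r; apply: ideal0.
  by rewrite -natr1 mulrDl mul1r; apply: idealD.
case: c => n; first by rewrite -[Posz n]natz rmorph_nat.
by rewrite NegzE -natz rmorphN rmorph_nat mulNr; apply: idealN.
Qed.

(** Acting by [bar f] turns the factor [X] into [k (1 - k)], which [geqv_smul] removes. *)
Lemma ideal_satX F : ideal ('X * F) -> ideal F.
Proof.
have [p [q ->]] := poly_psum F; rewrite mulrBr -!psumX => /ideal_indep.
rewrite !map_monS => /(geqv_act (bar f)) e; exists p, q; split=> //.
apply: (@geqv_smul 1); apply: geqv_trans (eqv_geqv (act_bar_f _)).
by apply: geqv_trans e; apply/geqv_sym/eqv_geqv/act_bar_f.
Qed.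

Lemma ideal_sat1X F : ideal ((1 - 'X) * F) -> ideal F.
Proof.
have [p [q ->]] := poly_psum F.
have -> : (1 - 'X) * (psum p - psum q) =
    psum (p ++ map S q) - psum (q ++ map S p).
  by rewrite !psum_cat !psumX; ring.
move=> /ideal_indep; rewrite !map_cat !map_monS.
set P := map mon p; set Q := map mon q => e; exists p, q; split=> //.
have add l : geqv l (map (act (bar f)) l ++ map (act f) l).
  exact/geqv_sym/eqv_geqv/act_bar_add.
(* Writing [P] and [Q] as [(1 - k) P + k P] and [(1 - k) Q + k Q], both sides of [e] contain
   [k P + k Q], which cancels. *)
have {}e : geqv (map (act (bar f)) P) (map (act (bar f)) Q).
  apply: (@geqv_cancel (map (act f) P ++ map (act f) Q)).
  rewrite [X in geqv X]catA.
  apply: geqv_trans (geqv_cat (geqv_sym (add P)) (geqv_refl _)) _.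
  apply: geqv_trans e _.
  apply: geqv_trans (geqv_cat (add Q) (geqv_refl _)) _; rewrite -catA.
  exact: geqv_cat (geqv_refl _) (eqv_geqv (eqv_catC _ _)).
apply: (@geqv_smul 1); apply: geqv_trans (eqv_geqv (act_f_bar _)).
apply: geqv_trans (geqv_act f e); exact/geqv_sym/eqv_geqv/act_f_bar.
Qed.

(** The term realizing [vsum] inside [C]: it condenses a scaled list into one element, as
    [no_absorption] requires. *)
Fixpoint csum K (l : seq (C 1)) : C 1 :=
  match K, l with
  | K'.+1, u :: l' =>
    cmul f (cmul f zero (iter K' (act sgC) u)) (cmul f (csum K' l') zero)
  | _, _ => zero
  end.

Lemma valo_csum K l o y : valo o y (csum K l) = vs o K y l.
Proof.
elim: K l => [|K IH] [|u l] /=; rewrite ?/valo ?bop_proj0 //.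
rewrite /bop !phi_cmul !phi_proj -!/(bop phi _ o y) -!/(valo o y _).
by rewrite IH valo_iter_sgC.
Qed.

Lemma smulE m l : smul m l = map (iter m (act sgC)) l.
Proof.
elim: m => [|m IH]; first by rewrite map_id.
by rewrite /smul iterS -/(smul m l) IH -map_comp.
Qed.

Lemma eqv_csum l : smul (size l) l ~~ [:: csum (size l) l].
Proof.
apply: (@eqv_at (size l).+1) => [|//|o y]; first by rewrite smulE size_map.
rewrite [map _ [:: _]]/= (vsum1 mxx mACA) valo_csum iterSr.
rewrite -(vsumS mxx mACA) ?size_map // -(map_iter_sg mxx mACA) smulE -!map_comp.
congr vsum; apply: eq_map => h; exact: valo_iter_sgC.
Qed.

Lemma ideal_proper : ~ ideal 1.
Proof.
have -> : 1 = psum [:: 0%N] - psum [::].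
  by rewrite psum_cons /psum big_nil addr0 subr0.
move=> /ideal_indep[m [k]]; rewrite /= [smul m [::]]smulE smulE /= => e.
have := eqv_smul (size k) e; rewrite [smul _ (_ :: _)]smulE /= -smulE.
set mu := iter (size k) _ _ => {}e; apply: one_nz.
apply: (@sgC_nzd m); apply: (@sgC_nzd (size k)).
apply: (@no_absorption _ (csum (size k) k)).
apply: eqv_trans (eqv_catl [:: mu] (eqv_sym (eqv_csum k))) _.
exact: eqv_trans e (eqv_csum k).
Qed.

(* [tcoef i t] is the coefficient of the variable [i] in [t] when
   [x ** y = (1 - X) x + X y]. *)
Fixpoint tcoef (X : eqType) (i : X) (t : tree X) : {poly int} :=
  match t with
  | Lf j => (i == j)%:R
  | Nd t1 t2 => (1 - 'X) * tcoef i t1 + 'X * tcoef i t2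
  end.

(** Giving the variable [i] the value [y] and all others the origin reads off its coefficient. *)
Lemma tcoef_geqv (X : eqType) (i : X) (t : tree X) : exists p q,
  tcoef i t = psum p - psum q /\
  geqv ([:: ev (cmul f (n := 1)) (upd (fun=> zero) i one) t] ++ map mon q)
    (map mon p).
Proof.
elim: t => [j|t1 [p1 [q1 [c1 e1]]] t2 [p2 [q2 [c2 e2]]]] /=.
  rewrite /upd eq_sym; case: eqP => _.
    exists [:: 0%N], [::]; rewrite psum_cons /psum big_nil addr0 subr0.
    by split=> //; apply: geqv_refl.
  exists [::], [::]; rewrite subrr; split=> //.
  exact/eqv_geqv/eqv_zero.
exists ((p1 ++ map S p2) ++ map S q1), ((q1 ++ map S q2) ++ map S p1).
split; first by rewrite c1 c2 !psum_cat !psumX; ring.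
set g1 := ev _ _ t1 in e1 *; set g2 := ev _ _ t2 in e2 *.
rewrite !map_cat !map_monS; set P1 := map mon p1; set P2 := map mon p2.
set Q1 := map mon q1; set Q2 := map mon q2.
have {}e1 := geqv_act (bar f) e1; have {}e2 := geqv_act f e2.
rewrite !map_cat /= in e1 e2; set RQ1 := map _ Q1 in e1; set RP1 := map _ P1 in e1.
set LQ2 := map _ Q2 in e2 *; set LP2 := map _ P2 in e2 *.
have bQ := act_bar_add Q1; rewrite -/RQ1 in bQ; set LQ1 := map _ Q1 in bQ *.
have bP := act_bar_add P1; rewrite -/RP1 in bP; set LP1 := map _ P1 in bP *.
have g12 : [:: cmul f g1 g2] ~~ [:: act (bar f) g1] ++ [:: act f g2].
  rewrite [act (bar f) g1]/act /bar {2}/cmul ccomp_cmul !ccomp_projl.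
  exact: eqv_act2.
apply: geqv_trans (eqv_geqv (eqv_catr _ g12)) _.
rewrite -[act (bar f) g1 :: _]cat1s -[act f g2 :: _]cat1s in e1 e2.
move: e1 e2; set G1 := [:: act _ _]; set G2 := [:: act _ _] => e1 e2.
clearbody G1 G2.
have e := geqv_cat (geqv_cat e1 e2) (geqv_refl (LQ1 ++ LP1)).
have eQ : (G1 ++ G2) ++ (Q1 ++ LQ2) ++ LP1 ~~
    ((G1 ++ RQ1) ++ (G2 ++ LQ2)) ++ (LQ1 ++ LP1).
  apply: eqv_trans (eqv_catl (G1 ++ G2) (eqv_catr LP1 (eqv_catr LQ2 (eqv_sym bQ)))) _.
  (* The blocks are reordered by a permutation of their indices, checked by computation. *)
  have := @eqv_flatten (nth [::] [:: G1; G2; RQ1; LQ1; LQ2; LP1])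
    [:: 0; 1; 2; 3; 4; 5]%N [:: 0; 2; 1; 4; 3; 5]%N isT.
  by rewrite /= !cats0 !catA.
have eP : (RP1 ++ LP2) ++ (LQ1 ++ LP1) ~~ (P1 ++ LP2) ++ LQ1.
  apply: eqv_trans (eqv_catr LQ1 (eqv_catr LP2 bP)).
  have := @eqv_flatten (nth [::] [:: RP1; LP2; LQ1; LP1])
    [:: 0; 1; 2; 3]%N [:: 0; 3; 1; 2]%N isT.
  by rewrite /= !cats0 !catA.
exact: geqv_trans (eqv_geqv eQ) (geqv_trans e (eqv_geqv eP)).
Qed.

Lemma ideal_tcoef n (t t' : tree 'I_n.+1) i :
  evC f t = evC f t' -> ideal (tcoef i t - tcoef i t').
Proof.
move=> e; have [p [q [-> e1]]] := tcoef_geqv i t.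
have [p' [q' [-> e2]]] := tcoef_geqv i t'.
have {}e : ev (cmul f (n := 1)) (upd (fun=> zero) i one) t =
    ev (cmul f (n := 1)) (upd (fun=> zero) i one) t'.
  by rewrite -!ccomp_evC e.
rewrite e in e1; move: e1 e2; set g := ev _ _ _ => e1 e2.
exists (p ++ q'), (q ++ p'); rewrite !psum_cat !map_cat.
split; first by ring.
apply: geqv_trans (geqv_cat (geqv_sym e1) (geqv_refl _)) _.
apply: geqv_trans (geqv_cat (geqv_refl _) e2).
apply/eqv_geqv.
have := @eqv_flatten (nth [::] [:: [:: g]; map mon q; map mon q'])
    [:: 0; 1; 2]%N [:: 1; 0; 2]%N isT.
by rewrite /= cats0 -[in g :: (map mon q ++ _)]cat1s.
Qed.

(** Modulo the ideal, [Z = b + Z^2 h]. If [b = 0], saturation cancels [Z] and [h] is an inverse; if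
    [b = 1], the inverse is [1 - Z h]. *)
Lemma ideal_unit_of (Z : {poly int}) (b : bool) h :
  (forall F, ideal (Z * F) -> ideal F) -> ideal (Z - (b%:R + Z ^+ 2 * h)) ->
  exists h', ideal (1 - Z * h').
Proof.
case: b => sat; last first.
  move=> iZ; exists h; apply: sat; congr ideal: iZ; rewrite /= mulr0n; ring.
move/idealN => iZ; exists (1 - Z * h); congr ideal: iZ.
by rewrite /= mulr1n; ring.
Qed.

(** The operation [x(xy)] is [(1 - X^2) x + X^2 y], so modulo [X^2] a term over it reduces to its
    leftmost variable. *)
Lemma tcoef_right_square (t : tree 'I_2) : exists t' h,
  evC (act f f) t = evC f t' /\
  tcoef ord_max t' = (ord_max == lvar t)%:R + 'X ^+ 2 * h.
Proof.
elim: t => [i|t1 [t1' [h1 [e1 c1]]] t2 [t2' [h2 [e2 c2]]]].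
  by exists (Lf i), 0; rewrite mulr0 addr0.
exists (Nd t1' (Nd t1' t2')), (h1 + (tcoef ord_max t2' - tcoef ord_max t1')).
split; last by rewrite /= c1; ring.
have -> : evC (act f f) (Nd t1 t2) =
    ccomp (act f f) (pr2 (evC (act f f) t1) (evC (act f f) t2)) by [].
rewrite e1 e2 /act ccomp_cmul ccomp_projl -[X in cmul f _ (ccomp X _)]cmul_proj.
by rewrite ccomp_cmul !ccomp_projl.
Qed.

(** By minimality [f] is a term over [x(xy)], unless the latter is a projection; so [X] is [0] or
    [1] modulo [X^2] and the ideal. The law [x(xy) = x] is excluded, and [x(xy) = y] gives
    [X^2 = 1]. *)
Lemma ideal_unitX : exists h, ideal (1 - 'X * h).
Proof.
pose t0 : tree 'I_2 := Nd (Lf ord0) (Lf ord_max).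
have et0 : evC f t0 = f by apply: cmul_proj.
have ct0 : tcoef ord_max t0 = 'X by rewrite /=; ring.
have [/is_proj2[e|e]|nff] := classicP (is_proj (act f f)).
- case: (hN npf) => x y; rewrite -[LHS]/(bop phi f x (valo x y f)).
  by rewrite -valo_act e /valo bop_proj0.
- have /ideal_tcoef : evC f (Nd (Lf ord0) t0) = evC f (Lf ord_max).
    by rewrite -[LHS]/(act f (evC f t0)) et0 e.
  by move=> /(_ ord_max)/idealN iX; exists 'X; congr ideal: iX; rewrite /=; ring.
have [t et] := min_tree hmin nff f.
have [t' [h [e c]]] := tcoef_right_square t.
have /(ideal_tcoef ord_max) : evC f t0 = evC f t' by rewrite et0 -e.
by rewrite ct0 c; apply: ideal_unit_of; apply: ideal_satX.
Qed.

Lemma tcoef_left_square (t : tree 'I_2) : exists t' h,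
  evC (cmul f f one) t = evC f t' /\
  tcoef ord0 t' = (ord0 == rvar t)%:R + (1 - 'X) ^+ 2 * h.
Proof.
elim: t => [i|t1 [t1' [h1 [e1 c1]]] t2 [t2' [h2 [e2 c2]]]].
  by exists (Lf i), 0; rewrite mulr0 addr0.
exists (Nd (Nd t1' t2') t2'), (h2 + (tcoef ord0 t1' - tcoef ord0 t2')).
split; last by rewrite /= c2; ring.
have -> : evC (cmul f f one) (Nd t1 t2) =
  ccomp (cmul f f one) (pr2 (evC (cmul f f one) t1) (evC (cmul f f one) t2)).
  by [].
rewrite e1 e2 ccomp_cmul ccomp_projl -[X in cmul f (ccomp X _)]cmul_proj.
by rewrite ccomp_cmul !ccomp_projl.
Qed.

Lemma ideal_unit1X : exists h, ideal (1 - (1 - 'X) * h).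
Proof.
pose t0 : tree 'I_2 := Nd (Lf ord0) (Lf ord_max).
have et0 : evC f t0 = f by apply: cmul_proj.
have ct0 : tcoef ord0 t0 = 1 - 'X by rewrite /=; ring.
have [/is_proj2[e|e]|nff] := classicP (is_proj (cmul f f one)).
- have /ideal_tcoef : evC f (Nd t0 (Lf ord_max)) = evC f (Lf ord0).
    by rewrite -[LHS]/(cmul f (evC f t0) one) et0 e.
  move=> /(_ ord0)/idealN iX; exists (1 - 'X); congr ideal: iX.
  by rewrite /=; ring.
- have e' x y : (x ** y) ** y = y.
    have := congr1 (fun g => valo x y g) e.
    by rewrite /valo {1}/bop phi_cmul bop_proj1 phi_proj.
  (* The law [(xy)y = y] is the excluded [x(xy) = x] for the opposite operation. *)
  have nopp : ~ is_proj (opp f).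
    have [n0 n1] := (nproj2 hmin hnt f).1 npf.
    apply/(nproj2 hmin hnt); split=> h; [apply: n1 | apply: n0] => x y;
      by have := h y x; rewrite bop_opp.
  by case: (hN nopp) => x y; rewrite !bop_opp e'.
have [t et] := min_tree hmin nff f.
have [t' [h [e c]]] := tcoef_left_square t.
have /(ideal_tcoef ord0) : evC f t0 = evC f t' by rewrite et0 -e.
by rewrite ct0 c; apply: ideal_unit_of; apply: ideal_sat1X.
Qed.

End FormalSums.

(** * Finite fields and affine clones *)

Section PolyIdeals.
Local Open Scope ring_scope.
Variable I : {poly int} -> Prop.
Hypotheses (ID : forall F G, I F -> I G -> I (F + G)).
Hypotheses (IM : forall G F, I F -> I (G * F)).
Hypotheses (I1 : ~ I 1) (IX : exists h, I (1 - 'X * h)).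

Lemma map_intr_eq0 (K : fieldType) p (F : {poly int}) : p \in [pchar K] ->
  map_poly (intr : int -> K) F = 0 -> exists G, F = p%:R * G.
Proof.
move=> pK F0; exists (\poly_(i < size F) (F`_i %/ p)%Z).
apply/polyP => i; rewrite mulr_natl coefMn coef_poly; case: ltnP => iF; last first.
  by rewrite nth_default // mul0rn.
have := congr1 (fun P : {poly K} => P`_i) F0; rewrite coef_map coef0 /= => e.
by rewrite -mulr_natr natz divzK // (dvdz_pcharf pK) e.
Qed.

Lemma unit_nz h : 1 - 'X * h != 0 :> {poly int}.
Proof.
apply/eqP => /(congr1 (fun P : {poly int} => P.[0])).
by rewrite !hornerE ?mul0r ?mulr0 ?oppr0 ?addr0 => /eqP.
Qed.

(** If [I] contains a positive integer, take a prime divisor of the least one. Otherwise let [d] in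
    [I] have least degree, which is positive: pseudo-division makes every element of [I], up to a
    power of the leading coefficient, a multiple of [d], and any prime not dividing that coefficient
    works. *)
Lemma ideal_prime : exists2 p, prime p &
  forall F G, I F -> F + p%:R * G <> 1.
Proof.
have I0 : I 0 by have [h /(IM 0)] := IX; rewrite mul0r.
have IN F : I F -> I (- F) by move=> /(IM (- 1)); rewrite mulN1r.
have [[n n0 In]|noconst] := classicP (exists2 n, (0 < n)%N & I n%:R).
  elim/ltn_ind: n n0 In => n IH n0 In.
  have [[m [mn m0 Im]]|nmin] := classicP (exists m, [/\ (m < n)%N, (0 < m)%N & I m%:R]).
    exact: IH mn m0 Im.
  have n1 : (1 < n)%N.
    by rewrite ltn_neqAle n0 andbT; apply/eqP => n1; apply: I1; rewrite -n1 in In.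
  exists (pdiv n); first exact: pdiv_prime.
  move=> F G iF e; apply: nmin; exists (n %/ pdiv n)%N; split.
  - by rewrite ltn_Pdiv ?prime_gt1 ?pdiv_prime.
  - by rewrite divn_gt0 ?pdiv_gt0 // dvdn_leq // pdiv_dvd.
  have := congr1 (fun u : {poly int} => (n %/ pdiv n)%:R * u) e.
  rewrite mulr1 mulrDr => <-; apply: ID; first exact: IM.
  rewrite mulrA -natrM divnK ?pdiv_dvd // mulrC; exact: IM.
have noC (c : int) : c != 0 -> ~ I c%:P.
  move=> c0 Ic; apply: noconst; exists `|c|%N; first by rewrite absz_gt0.
  have -> : (`|c|%N)%:R = (Num.sg c)%:P * c%:P :> {poly int}.
    by rewrite -polyCM -Num.Theory.normrEsg -abszE -[in RHS]natz rmorph_nat.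
  exact: IM.
pose P n := `[< exists F, [/\ I F, F != 0 & size F = n] >].
have exP : exists n, P n.
  have [h Ih] := IX; exists (size (1 - 'X * h)); apply/asboolP.
  by exists (1 - 'X * h); rewrite unit_nz.
case: (ex_minnP exP) => m /asboolP[d [Id d0 <-]] dmin.
have size_d : (1 < size d)%N.
  rewrite ltnNge; apply/negP => /size1_polyC de.
  by rewrite de in Id; apply: noC Id; rewrite -polyC_eq0 -de.
set c := lead_coef d; have c0 : c != 0 by rewrite lead_coef_eq0.
have [p cp pp] := prime_above `|c|; exists p => // F G IF e.
have pK := pchar_Fp pp; set K := 'F_p in pK.
have dF : c ^+ scalp F d *: F = F %/ d * d.
  have Fe := Pdiv.Idomain.divp_eq F d.
  suff r0 : F %% d = 0 by rewrite Fe r0 addr0.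
  apply/eqP/negPn/negP => r0; have := ltn_modp F d; rewrite d0 ltnNge.
  rewrite dmin //; apply/asboolP; exists (F %% d); split=> //.
  have -> : F %% d = c ^+ scalp F d *: F + - (F %/ d) * d by rewrite Fe; ring.
  by apply: ID; [rewrite -mul_polyC|]; apply: IM.
have := congr1 (fun u : {poly int} => c ^+ scalp F d *: u) e.
move: dF; move: (F %/ d) (scalp F d) => Q k dF.
rewrite scalerDr dF => /(congr1 (map_poly (intr : int -> K))).
have p0 : map_poly (intr : int -> K) p%:R = 0 
  by rewrite rmorph_nat -polyC_natr (pcharf0 pK).
rewrite rmorphD rmorphM /= !map_polyZ /= rmorphM /= p0 mul0r scaler0 addr0.
rewrite rmorph1 alg_polyC => e1.
have cK0 : c%:~R != 0 :> K.
  rewrite -(dvdz_pcharf pK) dvdzE /=; apply: contraL cp => /dvdn_leq.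
  by rewrite absz_gt0 -leqNgt; apply.
have ck0 : (c ^+ k)%:~R != 0 :> K by rewrite rmorphXn expf_neq0.
have sd : size (map_poly (intr : int -> K) d) = size d.
  exact: size_map_poly_id0.
have := congr1 (fun u : {poly K} => size u) e1; rewrite size_polyC ck0.
have [-> |Q0] := eqVneq (map_poly (intr : int -> K) Q) 0.
  by rewrite mul0r size_poly0.
rewrite size_mul // ?sd; last by rewrite -size_poly_eq0 sd size_poly_eq0.
rewrite -size_poly_gt0 in Q0 *; move: Q0 size_d => /=.
move: (size (map_poly _ Q)) (size d) => a b; lia.
Qed.

Lemma Fp_poly_lift p (f : {poly 'F_p}) :
  exists F : {poly int}, map_poly intr F = f.
Proof.
exists (\poly_(i < size f) (nat_of_ord (f`_i))%:Z); apply/polyP => i.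
rewrite coef_map coef_poly; case: ltnP => lif; last by rewrite nth_default.
by rewrite /= -pmulrn natr_Zp.
Qed.

(** The image of [I] in the polynomials over ['F_p] consists of multiples of an element [d] of least
    size. It is not constant, as otherwise [I] and [p] would generate [1], so it has a root in its
    splitting field. *)
Lemma ideal_finite_root : exists (L : finFieldType) (a : L),
  forall F, I F -> (map_poly intr F).[a] = 0.
Proof.
have [p pp Ip] := ideal_prime; have pK := pchar_Fp pp; set K := 'F_p in pK.
pose P n := `[< exists F, [/\ I F, map_poly (intr : int -> K) F != 0
  & size (map_poly (intr : int -> K) F) = n] >].
have exP : exists n, P n.
  have [h Ih] := IX; exists (size (map_poly (intr : int -> K) (1 - 'X * h))).
  apply/asboolP; exists (1 - 'X * h); split=> //; apply/eqP.
  move=> /(congr1 (fun P : {poly K} => P.[0])) /eqP.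
  rewrite rmorphB rmorph1 rmorphM /= map_polyX !hornerE ?mul0r ?subr0.
  by rewrite oner_eq0.
case: (ex_minnP exP) => m /asboolP[D [ID' d0 sD]] dmin.
set d := map_poly _ D in d0 sD.
have dvd F : I F -> d %| map_poly (intr : int -> K) F.
  move=> IF; rewrite /dvdp; apply/negPn/negP => r0.
  have := ltn_modp (map_poly (intr : int -> K) F) d; rewrite d0 ltnNge sD dmin //.
  apply/asboolP; have [Q eQ] := Fp_poly_lift (map_poly (intr : int -> K) F %/ d).
  exists (F + - Q * D).
  have -> : map_poly (intr : int -> K) (F + - Q * D) =
      map_poly (intr : int -> K) F %% d.
    rewrite rmorphD rmorphM rmorphN /= eQ -/d.
    by rewrite {1}(divp_eq (map_poly intr F) d); ring.
  by split=> //; apply: ID => //; apply: IM.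
have size_d : (1 < size d)%N.
  rewrite ltnNge; apply/negP => /size1_polyC de.
  have [Q eQ] := Fp_poly_lift (d`_0)^-1%:P.
  have : map_poly (intr : int -> K) (1 - Q * D) = 0.
    rewrite rmorphB rmorph1 rmorphM /= eQ -/d de coefC eqxx -polyCM mulVf ?subrr //.
    by rewrite -polyC_eq0 -de.
  move/(map_intr_eq0 pK) => [G eG]; apply: (Ip (Q * D) G); first exact: IM.
  by rewrite -eG addrC subrK.
have [L [rs /= eqd _]] := FinSplittingFieldFor d0.
case: rs eqd => [|a rs] eqd.
  move: size_d; rewrite -(size_map_poly (in_alg L)) (eqp_size eqd).
  by rewrite big_nil size_poly1.
have da : root (map_poly (in_alg L) d) a.
  by rewrite (eqp_root eqd) root_prod_XsubC mem_head.
exists (FinFieldExtType L), a => F /dvd/dvdpP[Q eQ].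
have -> : map_poly (intr : int -> L) F =
    map_poly (in_alg L) (map_poly (intr : int -> K) F).
  rewrite -map_poly_comp; apply: eq_map_poly => n /=.
  by rewrite scaler_int.
by rewrite eQ rmorphM hornerM (rootP da) mulr0.
Qed.

End PolyIdeals.

(** * The operation [x - y + z] and affine clones over prime fields *)

Section Maltsev.
Local Open Scope ring_scope.

Lemma nonproj_maltsev (K : fieldType) (i : 'I_3) :
  ~ forall x : 'I_3 -> K, x ord0 - x ord31 + x ord_max = x i.
Proof.
have o0 : (1 : K) != 0 := oner_neq0 K.
move: i; apply: ord3P => e.
- by have := e (pr3 0 0 1); rewrite /pr3 /= subr0 add0r => /eqP; apply/negP.
- by have := e (pr3 1 0 0); rewrite /pr3 /= subr0 addr0 => /eqP; apply/negP.
by have := e (pr3 1 0 0); rewrite /pr3 /= subr0 addr0 => /eqP; apply/negP.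
Qed.

Variables (C : abs_clone) (f : C 1) (K : finFieldType) (k : K).
Variable psi : representation C K.
Hypothesis hpsi : forall x y, bop psi f x y = (1 - k) * x + k * y.
Hypotheses (k0 : k != 0) (k1 : k != 1).

(* With [N + 1] a multiple of the orders of [k] and [1 - k], the iterated
   translations are the two division operations. *)
Lemma maltsev_term : exists m : C 2, forall x,
  psi _ m x = x ord0 - x ord31 + x ord_max.
Proof.
pose N := (#|K| - 2)%N; have cK := finNzRing_gt1 K.
have XN (a : K) : a != 0 -> a * a ^+ N = 1.
  move=> a0; apply: (mulfI a0); rewrite mulr1 -!exprS.
  by rewrite -[N.+2]addn2 subnK // expf_card.
pose px : C 2 := cproj ord0; pose py : C 2 := cproj ord31.
pose pz : C 2 := cproj ord_max.
pose rd := iter N (fun z => cmul f z py) px.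
pose ld := iter N (fun z => cmul f py z) pz.
have rdE x : psi _ rd x = (1 - k) ^+ N * (x ord0 - x ord31) + x ord31.
  rewrite /rd; elim: N {XN rd ld} => [|n IH] /=.
    by rewrite phi_proj expr0; ring.
  by rewrite phi_cmul IH hpsi phi_proj exprS; ring.
have ldE x : psi _ ld x = k ^+ N * (x ord_max - x ord31) + x ord31.
  rewrite /ld; elim: N {XN rd ld rdE} => [|n IH] /=.
    by rewrite phi_proj expr0; ring.
  by rewrite phi_cmul IH hpsi phi_proj exprS; ring.
exists (cmul f rd ld) => x; rewrite phi_cmul rdE ldE hpsi.
rewrite !mulrDr !mulrA !XN //; last by rewrite subr_eq0 eq_sym.
ring.
Qed.

End Maltsev.

Section AffineRepresentation.
Local Open Scope ring_scope.
Variables (C : abs_clone) (K : fieldType) (psi : representation C K).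
Hypothesis hmin : clone_minimal C.
Hypothesis K_prime : forall k : K, exists n : nat, k = n%:R.
Hypothesis psi_lin : forall n (g : C n), exists c : 'I_n.+1 -> K,
  \sum_i c i = 1 /\ forall x, psi _ g x = \sum_i c i * x i.
Variable m : C 2.
Hypothesis hm : forall x, psi _ m x = x ord0 - x ord31 + x ord_max.

Definition m3 n (a b c : C n) : C n := ccomp m (pr3 a b c).

Lemma psi_m3 n (a b c : C n) x :
  psi _ (m3 a b c) x = psi _ a x - psi _ b x + psi _ c x.
Proof. by rewrite /m3 phi_comp hm. Qed.

Lemma psi_nontrivial : ~ alg_trivial (rep_alg psi).
Proof.
move/alg_trivialP => /(_ _ m)[i ei]; apply: (@nonproj_maltsev K i) => x.
by rewrite -hm ei.
Qed.

Let abs := absorb hmin psi_nontrivial.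

(** Only absorption identities are lifted: [m(g, h, p) = p], [m(a, a, b) = b] and
    [m(m(a, b, c), c, b) = a]. Together they give [g = m(m(g, h, p), p, h) = m(p, p, h) = h]. *)
Lemma psi_inj n (g h : C n) : (forall x, psi _ g x = psi _ h x) -> g = h.
Proof.
move=> e; pose p : C n := cproj ord0.
have ghp : m3 g h p = p by apply: abs => x; rewrite psi_m3 e phi_proj; ring.
have mxxz a b : m3 a a b = b :> C n.
  have e2 : m3 (cproj ord0) (cproj ord0) (cproj ord_max) = cproj ord_max :> C 1.
    by apply: abs => x; rewrite psi_m3 !phi_proj; ring.
  have := congr1 (fun u => ccomp u (pr2 a b)) e2.
  rewrite /= /m3 ccompA (comp_pr3 (fun u => ccomp u (pr2 a b))).
  by rewrite !ccomp_projl.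
have mm a b c : m3 (m3 a b c) c b = a :> C n.
  have e3 : m3 (m3 (cproj ord0) (cproj ord31) (cproj ord_max))
      (cproj ord_max) (cproj ord31) = cproj ord0 :> C 2.
    by apply: abs => x; rewrite !psi_m3 !phi_proj; ring.
  have := congr1 (fun u => ccomp u (pr3 a b c)) e3.
  rewrite /= /m3 ccompA (comp_pr3 (fun u => ccomp u (pr3 a b c))).
  rewrite ccompA (comp_pr3 (fun u => ccomp u (pr3 a b c))).
  by rewrite !ccomp_projl.
by rewrite -(mm g h p) ghp mxxz.
Qed.

Lemma affine_abelian_rep : exists (A : Type) (phi : representation C A),
    ~ alg_trivial (rep_alg phi) /\ abelian_alg (rep_alg phi).
Proof.
exists K, psi; split; first exact: psi_nontrivial.
apply: affine_abelian => n g x y z; have [c [_ ec]] := psi_lin g.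
by rewrite !ec -sumrB -big_split; apply: eq_bigr => i _ /=; ring.
Qed.

Lemma affine_clone_mem n (g : C n) :
  term_ops (vect_alg K^o) n (psi _ g) /\ forall x, psi _ g (fun=> x) = x.
Proof.
have [c [c1 ec]] := psi_lin g; split; last first.
  by move=> x; rewrite ec -mulr_suml c1 mul1r.
have -> : psi _ g = (fun x => \sum_i c i * x i) by apply: funext.
pose T := term_ops (vect_alg K^o).
have T0 : T n (fun=> 0).
  have := Gen_comp (C := op_clone K) (X := @basic_op (vect_alg K^o))
    (f := @basic (vect_alg K^o) VZero) (g := fun=> (@cproj (op_clone K) n ord0)).
  apply; last by move=> _; apply: Gen_proj.
  exact/Gen_base/(Basic_op (A := vect_alg K^o) VZero).
have TD s t : T n s -> T n t -> T n (fun x => s x + t x).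
  move=> Ts Tt.
  have := Gen_comp (C := op_clone K) (X := @basic_op (vect_alg K^o))
    (f := @basic (vect_alg K^o) VAdd) (g := pr2 s t).
  apply; last exact: ord2P.
  exact/Gen_base/(Basic_op (A := vect_alg K^o) VAdd).
have TZ a i : T n (fun x => a * x i).
  have := Gen_comp (C := op_clone K) (X := @basic_op (vect_alg K^o))
    (f := @basic (vect_alg K^o) (VScale a)) (g := fun=> (@cproj (op_clone K) n i)).
  apply; last by move=> _; apply: Gen_proj.
  exact/Gen_base/(Basic_op (A := vect_alg K^o) (VScale a)).
suff Tsum (s : seq 'I_n.+1) : T n (fun x => \sum_(i <- s) c i * x i).
  exact: Tsum.
elim: s => [|i s IH].
  have -> : (fun x : 'I_n.+1 -> K => \sum_(i <- [::]) c i * x i) = (fun=> 0).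
    by apply: funext => x; rewrite big_nil.
  exact: T0.
have -> : (fun x : 'I_n.+1 -> K => \sum_(j <- i :: s) c j * x j) =
    (fun x => c i * x i + \sum_(j <- s) c j * x j).
  by apply: funext => x; rewrite big_cons.
exact: TD.
Qed.

Lemma term_op_linear n t : term_ops (vect_alg K^o) n t ->
  exists c : 'I_n.+1 -> K, forall x, t x = \sum_i c i * x i.
Proof.
elim=> {n t} [n _ [[|||a]]|n i|n k h g _ [c ec] _ /choice[d ed]] /=.
- by exists (fun=> 0) => x; rewrite big1 // => i _; rewrite mul0r.
- by exists (fun=> - 1) => x; rewrite big_ord1 mulN1r.
- by exists (fun=> 1) => x; rewrite big_ord_recl big_ord1 !mul1r; congr (_ + x _);
    apply: val_inj.
- by exists (fun=> a) => x; rewrite big_ord1.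
- exists (fun j => (i == j)%:R) => x; rewrite (bigD1 i) //= eqxx mul1r big1 ?addr0 //.
  by move=> j /negPf nji; rewrite eq_sym nji mul0r.
exists (fun j => \sum_i c i * d i j) => x; rewrite ec.
under [LHS]eq_bigr => i _ do rewrite /= (ed i x) mulr_sumr.
rewrite exchange_big; apply: eq_bigr => j _ /=; rewrite mulr_suml.
by apply: eq_bigr => i _; rewrite mulrA.
Qed.

(** An affine combination is [x_0] plus the terms [c_i (x_i - x_0)]. Each [c_i] is a natural number,
    so the term is added by [c_i] applications of [m]. *)
Lemma affine_op_psi n (c : 'I_n.+1 -> K) : \sum_i c i = 1 ->
  exists g : C n, forall x, psi _ g x = \sum_i c i * x i.
Proof.
move=> c1; pose reach v := exists g : C n, forall x, psi _ g x = v x.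
suff R (s : seq 'I_n.+1) :
    reach (fun x => x ord0 + \sum_(i <- s) c i * (x i - x ord0)).
  have [g eg] := R (index_enum _); exists g => x; rewrite eg.
  under eq_bigr do rewrite mulrBr.
  by rewrite sumrB -mulr_suml c1 mul1r addrC subrK.
elim: s => [|i s [g eg]].
  by exists (cproj ord0) => x; rewrite phi_proj big_nil addr0.
have [k ek] := K_prime (c i).
suff [h eh] : reach (fun x => k%:R * (x i - x ord0) + psi _ g x).
  by exists h => x; rewrite eh eg big_cons ek addrCA.
elim: k {ek} => [|k [h eh]]; first by exists g => x; rewrite mul0r add0r.
exists (m3 h (cproj ord0) (cproj i)) => x.
by rewrite psi_m3 eh !phi_proj -[in RHS]natr1; ring.
Qed.

Lemma affine_iso : clone_iso C (affine_clone K^o).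
Proof.
pose chi n (g : C n) : affine_clone K^o n := exist _ (psi _ g) (affine_clone_mem g).
have chi_proj n (i : 'I_n.+1) : chi n (cproj i) = cproj i.
  by apply: sop_inj; rewrite /= hom_proj.
have chi_comp n k (h : C n) (g : 'I_n.+1 -> C k) :
    chi k (ccomp h g) = ccomp (chi n h) (fun i => chi k (g i)).
  by apply: sop_inj; rewrite /= hom_comp.
exists (CloneHom chi_proj chi_comp) => n; apply: bij_choice => /=.
  by move=> g h /(congr1 sval) /= e; apply: psi_inj => x; rewrite e.
move=> [t [tt it]]; have [c ec] := term_op_linear tt.
have c1 : \sum_i c i = 1.
  by have := it 1; rewrite ec => <-; apply: eq_bigr => i _; rewrite mulr1.
have [g eg] := affine_op_psi c1; exists g; apply: eq_exist.
by apply: funext => x; rewrite eg ec.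
Qed.

End AffineRepresentation.

Section TreeCoefficients.
Local Open Scope ring_scope.
Variables (K : fieldType) (k : K).

Definition kcoef (X : eqType) (i : X) (t : tree X) : K :=
  (map_poly intr (tcoef i t)).[k].

Lemma kcoef_Lf (X : eqType) (i j : X) : kcoef i (Lf j) = (i == j)%:R.
Proof. by rewrite /kcoef /= rmorph_nat -polyC_natr hornerC. Qed.

Lemma kcoef_Nd (X : eqType) (i : X) t1 t2 :
  kcoef i (Nd t1 t2) = (1 - k) * kcoef i t1 + k * kcoef i t2.
Proof.
by rewrite /kcoef /= rmorphD !rmorphM rmorphB rmorph1 /= map_polyX !hornerE.
Qed.

Lemma ev_kcoef (X : finType) (x : X -> K) t :
  ev (fun a b => (1 - k) * a + k * b) x t = \sum_i kcoef i t * x i.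
Proof.
elim: t => [j|t1 e1 t2 e2] /=.
  rewrite (bigD1 j) //= kcoef_Lf eqxx mul1r big1 ?addr0 // => i /negPf nij.
  by rewrite kcoef_Lf nij mul0r.
rewrite e1 e2 !mulr_sumr -big_split; apply: eq_bigr => i _ /=.
by rewrite kcoef_Nd; ring.
Qed.

Lemma sum_kcoef (X : finType) (t : tree X) : \sum_i kcoef i t = 1.
Proof.
have := ev_kcoef (fun=> 1) t; rewrite (eq_bigr (fun i => kcoef i t)) => [<-|i _];
  last by rewrite mulr1.
by elim: t => //= t1 -> t2 ->; ring.
Qed.

End TreeCoefficients.

Section IntegerCoefficients.
Local Open Scope ring_scope.
Variables (C : abs_clone) (L : fieldType) (psi : representation C L).

Let integer n (g : C n) : Prop := exists c : 'I_n.+1 -> int,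
  forall x, psi _ g x = \sum_i (c i)%:~R * x i.

Fact integer_proj n (i : 'I_n.+1) : integer (cproj i).
Proof.
exists (fun j => (i == j)%:R) => x.
rewrite phi_proj (bigD1 i) //= eqxx mul1r big1 ?addr0 //.
by move=> j /negPf nji; rewrite eq_sym nji mul0r.
Qed.

Fact integer_comp n m (h : C n) (g : 'I_n.+1 -> C m) :
  integer h -> (forall i, integer (g i)) -> integer (ccomp h g).
Proof.
move=> [c ec] /choice[d ed].
exists (fun j => \sum_i c i * d i j) => x; rewrite phi_comp ec.
under [LHS]eq_bigr => i _ do rewrite (ed i x) mulr_sumr.
rewrite exchange_big; apply: eq_bigr => j _ /=; rewrite rmorph_sum mulr_suml /=.
by apply: eq_bigr => i _; rewrite rmorphM mulrA.
Qed.

Definition integer_sub : subclone C := Subclone integer_proj integer_comp.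

Lemma integer_maltsev (m : C 2) :
  (forall x, psi _ m x = x ord0 - x ord31 + x ord_max) -> integer_sub _ m.
Proof.
move=> hm; exists (pr3 1 (- 1) 1) => x; rewrite hm !big_ord_recl big_ord0.
rewrite /pr3 /= mul1r mulrN1z mulN1r mul1r addr0 -addrA.
congr (_ + (- x _ + x _)); apply: val_inj => //.
Qed.

End IntegerCoefficients.

(** * The affine case: descent of the root to the prime field *)

Section AffineCase.
Local Open Scope ring_scope.
Variables (C : abs_clone) (A : Type) (phi : representation C A).
Hypotheses (hmin : clone_minimal C) (hnt : ~ alg_trivial (rep_alg phi)).
Hypothesis hwa : weakly_abelian (rep_alg phi).
Hypothesis hid : forall (f : C 1%N) x, bop phi f x x = x.
Hypothesis hN : forall f : C 1, ~ is_proj f ->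
  ~ forall x y, bop phi f x (bop phi f x y) = x.
Hypothesis hR : forall f : C 1, ~ is_proj f ->
  ~ forall x y, bop phi f x (bop phi f y x) = x.
Variable f : C 1.
Hypothesis npf : ~ is_proj f.

Local Notation I := (ideal phi f).

Lemma affine_root_rep (K : fieldType) (k : K) :
  (forall F, I F -> (map_poly intr F).[k] = 0) ->
  [/\ k != 0, k != 1 & exists psi : representation C K,
    forall n (t : tree 'I_n.+1) x,
      psi _ (evC f t) x = ev (fun a b => (1 - k) * a + k * b) x t].
Proof.
move=> root_k; split.
- apply/eqP => k0; have [h /root_k] := ideal_unitX hmin hnt hwa hid hN npf.
  rewrite rmorphB rmorph1 rmorphM /= map_polyX !hornerE k0 mul0r subr0 => /eqP.
  by rewrite oner_eq0.
- apply/eqP => k1; have [h /root_k] := ideal_unit1X hmin hnt hwa hid hN npf.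
  rewrite rmorphB rmorph1 rmorphM /= rmorphB rmorph1 /= map_polyX !hornerE k1.
  by rewrite subrr mul0r subr0 => /eqP; rewrite oner_eq0.
apply: transfer => [n g|n t t' e x]; first exact: min_tree.
rewrite !ev_kcoef; apply: eq_bigr => i _; congr (_ * _); apply/eqP.
rewrite -subr_eq0 /kcoef -hornerN -hornerD -rmorphB /=; apply/eqP/root_k.
exact: (ideal_tcoef hmin hnt hwa hid npf i e).
Qed.

Lemma affine_rep_bop (K : fieldType) (k : K) (psi : representation C K) :
  (forall n (t : tree 'I_n.+1) x,
      psi _ (evC f t) x = ev (fun a b => (1 - k) * a + k * b) x t) ->
  forall x y, bop psi f x y = (1 - k) * x + k * y.
Proof.
move=> psiE x y; rewrite -[f in LHS]cmul_proj.
exact: (psiE _ (Nd (Lf ord0) (Lf ord_max)) (pr2 x y)).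
Qed.

Lemma affine_rep_lin (K : fieldType) (k : K) (psi : representation C K) :
  (forall n (t : tree 'I_n.+1) x,
      psi _ (evC f t) x = ev (fun a b => (1 - k) * a + k * b) x t) ->
  forall n (g : C n), exists c : 'I_n.+1 -> K,
  \sum_i c i = 1 /\ forall x, psi _ g x = \sum_i c i * x i.
Proof.
move=> psiE n g; have [t ->] := min_tree hmin npf g.
exists (fun i => kcoef k i t); rewrite sum_kcoef; split=> // x.
by rewrite psiE ev_kcoef.
Qed.

Lemma affine_case :
  (exists (A : Type) (phi : representation C A),
    ~ alg_trivial (rep_alg phi) /\ abelian_alg (rep_alg phi)) /\
  exists (p : nat) (V : lmodType 'F_p),
    prime p /\ clone_iso C (affine_clone V).
Proof.
have [L [a root_a]] := ideal_finite_root
  (idealD hmin hwa hid npf)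
  (idealM hmin hwa hid npf)
  (ideal_proper hmin hnt hwa hid hN hR npf)
  (ideal_unitX hmin hnt hwa hid hN npf).
have [a0 a1 [psi psiE]] := affine_root_rep root_a.
have psi_f := affine_rep_bop psiE.
have [m hm] := maltsev_term psi_f a0 a1.
(* The elements acting with integer coefficients form a subclone containing the nonprojection
   [x - y + z], hence also [f], whose second coefficient is [a]. *)
have [c ac] : exists c : int, a = c%:~R.
  have nm : ~ is_proj m.
    move=> [i ei]; apply: (@nonproj_maltsev L i) => x.
    by rewrite -hm ei phi_proj.
  have [d ed] := min_ind hmin (S := integer_sub psi) (integer_maltsev hm) nm f.
  exists (d ord_max); have := psi_f 0 1.
  rewrite mulr0 add0r mulr1 /bop ed !big_ord_recl big_ord0 /=.
  by rewrite mulr0 add0r mulr1 addr0 => <-; congr (d _)%:~R; apply: val_inj.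
have [p pp pL] := finPcharP L; have pK := pchar_Fp pp.
(* The value at [c] is the image of an integer, and in either field it vanishes exactly when [p]
   divides that integer. *)
have root_c F : I F -> (map_poly intr F).[c%:~R] = 0 :> 'F_p.
  move=> /root_a; rewrite ac !horner_map /= => /eqP.
  by rewrite -(dvdz_pcharf pL) (dvdz_pcharf pK) => /eqP.
have [c0 c1 [chi chiE]] := affine_root_rep root_c.
have [m' hm'] := maltsev_term (affine_rep_bop chiE) c0 c1.
have Fp_nat (k : 'F_p) : exists n : nat, k = n%:R.
  by exists (nat_of_ord k); rewrite natr_Zp.
have chi_lin := affine_rep_lin chiE.
split; first exact: (affine_abelian_rep chi_lin hm').
exists p, ('F_p)^o%type; split=> //; exact: (affine_iso hmin Fp_nat chi_lin hm').
Qed.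

End AffineCase.

(** * Clones without binary operations *)

Section NoBinary.
Variables (C : abs_clone) (A : Type) (phi : representation C A).
Hypotheses (hmin : clone_minimal C) (hnt : ~ alg_trivial (rep_alg phi)).
Hypothesis hwa : weakly_abelian (rep_alg phi).

Let abs := absorb hmin hnt.

Lemma identify n (g : C n.+1) i j : i != j -> (forall h : C n, is_proj h) ->
  exists l, forall x, x i = x j -> phi _ g x = x l.
Proof.
move=> nij hn; have [j' ej] : exists j', j = lift i j'.
  by case: (unliftP i j) => [j' ->|e]; [exists j' | rewrite e eqxx in nij].
have [l el] := hn (ccomp g (fun k => cproj (odflt j' (unlift i k)))).
exists (lift i l) => x xij; have := congr1 (fun h => phi _ h (x \o lift i)) el.
rewrite phi_comp phi_proj /= => <-; congr (phi _ g _); apply: funext => k.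
rewrite phi_proj /=; case: unliftP => [k' -> //|->] /=.
by rewrite xij ej.
Qed.

(* The values under two disjoint identifications of variables agree up to a
   common choice of variable, hence weak abelianness makes [g] a projection. *)
Lemma no_large_arity n (g : C n) : 2 < n -> ~ is_proj g ->
  exists k (h : C k), k < n /\ ~ is_proj h.
Proof.
case: n g => // n g n2 ng; apply: contrapT => nh.
have hn (h : C n) : is_proj h.
  by apply: contrapT => ph; apply: nh; exists n, h.
have [u [v nuv]] := two_elements hnt.
pose o k : 'I_n.+2 := inord k.
have oE k l : k < 4 -> l < 4 -> (o k == o l) = (k == l).
  by move=> k4 l4; rewrite -val_eqE /= !inordK //; lia.
have [a ea] := identify (i := o 0) (j := o 1) g ltac:(by rewrite oE) hn.
have [b eb] := identify (i := o 2) (j := o 3) g ltac:(by rewrite oE) hn.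
(* Representatives under both identifications at once. A two-valued point constant on these classes
   satisfies both, which puts [a] and [b] in one class. *)
pose cl k := if k == o 1 then o 0 else if k == o 3 then o 2 else k.
have cl_ab : cl a = cl b.
  pose x k := if cl k == cl a then u else v.
  have x01 : x (o 0) = x (o 1) by rewrite /x /cl eqxx !oE.
  have x23 : x (o 2) = x (o 3) by rewrite /x /cl eqxx !oE.
  have := ea x x01; rewrite (eb x x23) /x eqxx.
  by case: eqP => // _ /esym.
have [c [c01 c23]] : exists c, (forall x, x (o 0) = x (o 1) -> phi _ g x = x c)
    /\ (forall x, x (o 2) = x (o 3) -> phi _ g x = x c).
  have [e|e] : (forall x : _ -> A, x (o 0) = x (o 1) -> x a = x b) \/
      (forall x : _ -> A, x (o 2) = x (o 3) -> x a = x b).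
  - move: cl_ab; rewrite /cl.
    case: (eqVneq a (o 1)) => [->|a1]; case: (eqVneq b (o 1)) => [->|b1]; try by left.
    + case: (eqVneq b (o 3)) => [->|b3]; first by move/eqP; rewrite oE.
      by move=> <-; left.
    + case: (eqVneq a (o 3)) => [->|a3]; first by move/eqP; rewrite oE.
      by move=> ->; left.
    case: (eqVneq a (o 3)) => [->|a3]; case: (eqVneq b (o 3)) => [->|b3]; try by left.
    + by move=> <-; right.
    + by move=> ->; right.
    by move=> ->; left.
  - by exists b; split=> // x x01; rewrite ea // e.
  by exists a; split=> // x x23; rewrite eb // -e.
have pick i j : i != j -> exists k k', [/\ k != c, k != k' &
    (k = i /\ k' = j) \/ (k = j /\ k' = i)].
  move=> nij; case: (eqVneq j c) => [jc|jc].
    by exists i, j; split; rewrite // -?jc //; left.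
  by exists j, i; split=> //; [rewrite eq_sym | right].
have [e [e' [ec ee e01]]] := pick (o 0) (o 1) ltac:(by rewrite oE).
have [d [d' [dc dd d23]]] := pick (o 2) (o 3) ltac:(by rewrite oE).
have ed : [/\ e != d, e' != d, e != d' & e' != d'].
  by case: e01 => -[-> ->]; case: d23 => -[-> ->]; rewrite !oE.
case: ed => ed e'd ed' e'd'.
apply: ng; exists c; apply: abs => x; symmetry.
(* Rows vary position [e] and columns position [d], one from each identified pair and both different
   from [c]. The value [x e'] at [e], or [x d'] at [d], enforces an identification, so three corners
   equal [x c]; the fourth is the value of [g] at [x]. *)
pose y r s := upd (upd x d s) e r.
have pol_y : pol phi (fun r _ _ s _ _ => phi _ g (y r s)).
  apply: (@pol_op _ _ phi _ g (fun k r _ _ s _ _ => y r s k)) => k.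
  rewrite /y /upd; case: eqP => _; first exact: pol_r0.
  by case: eqP => _; [apply: pol_c0 | apply: pol_const].
have yc r s : y r s c = x c.
  by rewrite /y /upd eq_sym (negPf ec) eq_sym (negPf dc).
have y01 s : phi _ g (y (x e') s) = x c.
  rewrite c01 ?yc //; have : y (x e') s e = y (x e') s e'.
    by rewrite /y /upd eqxx eq_sym (negPf ee) (negPf e'd).
  by case: e01 => -[-> ->].
apply: (wa3 hwa (a := (x e', u, u)) (b := (x e, u, u)) (c := (x d', u, u))
  (d := (x d, u, u)) pol_y) => /=.
- exact: y01.
- exact: y01.
- rewrite c23 ?yc //; have : y (x e) (x d') d = y (x e) (x d') d'.
    rewrite /y /upd eqxx ![_ == e]eq_sym (negPf ed) (negPf ed').
    by rewrite [d' == d]eq_sym (negPf dd).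
  by case: d23 => -[-> ->].
congr (phi _ g _); apply: funext => k; rewrite /y /upd.
by case: eqP => [->|_] //; case: eqP => [->|].
Qed.

Section Ternary.
Hypothesis hbin : forall h : C 1, is_proj h.
Variable g : C 2.
Hypothesis ng : ~ is_proj g.
Local Notation g3 x y z := (phi _ g (pr3 x y z)).

Lemma identify3 (s : bool -> C 1) (a b c : bool) :
  (forall e, s e = cproj (if e then ord_max else ord0)) ->
  (forall x y, g3 (if a then y else x) (if b then y else x)
      (if c then y else x) = x) \/
  (forall x y, g3 (if a then y else x) (if b then y else x)
      (if c then y else x) = y).
Proof.
move=> se; have [i ei] := hbin (ccomp g (pr3 (s a) (s b) (s c))).
have e x y : g3 (if a then y else x) (if b then y else x)
    (if c then y else x) = pr2 x y i.
  have := congr1 (fun h => phi _ h (pr2 x y)) ei.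
  rewrite phi_comp phi_proj (comp_pr3 (fun h => phi _ h (pr2 x y))) => <-.
  by rewrite !se !phi_proj; case: (a); case: (b); case: (c).
by case: (ord2_or i) e => ->; [left | right].
Qed.

Lemma pol_g3 a b c : pol phi a -> pol phi b -> pol phi c ->
  pol phi (fun r0 r1 r2 c0 c1 c2 => g3 (a r0 r1 r2 c0 c1 c2)
    (b r0 r1 r2 c0 c1 c2) (c r0 r1 r2 c0 c1 c2)).
Proof.
move=> pa pb pc; have := @pol_op _ _ phi _ g (pr3 a b c).
move=> /(_ (ord3P (P := fun i => pol phi (pr3 a b c i)) pa pb pc)).
congr pol; do 6!apply: funext => ?.
by congr (phi _ g _); rewrite (comp_pr3 (fun u => u _ _ _ _ _ _)).
Qed.

Ltac polyg := repeat (first [apply: pol_r0 | apply: pol_c0 | apply: pol_const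
  | apply: pol_g3]).

(** There are eight patterns for the three identifications. Weak abelianness turns the pattern of a
    projection into that projection everywhere, and the majority pattern and those with two minority
    laws into [u = v]. *)
Lemma ternary_minority : [/\ forall x y, g3 x x y = y,
  forall x y, g3 x y x = y & forall x y, g3 y x x = y].
Proof.
have [u [v nuv]] := two_elements hnt.
have tern i : ~ forall x, g3 (x ord0) (x ord31) (x ord_max) = x i.
  by move=> e; apply: ng; exists i; apply: abs => x; rewrite {1}(pr3_eta x) e.
pose s (e : bool) : C 1 := cproj (if e then ord_max else ord0).
have [r|r] := @identify3 s false false true (fun=> erefl);
have [q|q] := @identify3 s false true false (fun=> erefl);
have [p|p] := @identify3 s true false false (fun=> erefl); rewrite /= in p q r.
- case: nuv; apply: (wa3 hwa (t := fun a _ _ c _ _ => g3 a c u)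
    (a := (u, u, u)) (b := (v, u, u)) (c := (u, u, u)) (d := (v, u, u)));
    rewrite /= ?r ?q ?p //; by polyg.
- case: (tern ord0) => x; apply/esym; apply: (wa3 hwa
    (t := fun a _ _ c _ _ => g3 (x ord0) a c)
    (a := (x ord0, u, u)) (b := (x ord31, u, u))
    (c := (x ord31, u, u)) (d := (x ord_max, u, u)));
    rewrite /= ?r ?q ?p //; by polyg.
- case: (tern ord31) => x; apply/esym; apply: (wa3 hwa
    (t := fun a _ _ c _ _ => g3 a (x ord31) c)
    (a := (x ord31, u, u)) (b := (x ord0, u, u))
    (c := (x ord0, u, u)) (d := (x ord_max, u, u)));
    rewrite /= ?r ?q ?p //; by polyg.
- case: nuv; apply: (wa3 hwa (t := fun a _ _ c _ _ => g3 a c v)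
    (a := (u, u, u)) (b := (v, u, u)) (c := (u, u, u)) (d := (v, u, u)));
    rewrite /= ?r ?q ?p //; by polyg.
- case: (tern ord_max) => x; apply/esym; apply: (wa3 hwa
    (t := fun a _ _ c _ _ => g3 a c (x ord_max))
    (a := (x ord_max, u, u)) (b := (x ord0, u, u))
    (c := (x ord0, u, u)) (d := (x ord31, u, u)));
    rewrite /= ?r ?q ?p //; by polyg.
- case: nuv; apply: (wa3 hwa (t := fun a _ _ c _ _ => g3 a v c)
    (a := (u, u, u)) (b := (v, u, u)) (c := (u, u, u)) (d := (v, u, u)));
    rewrite /= ?r ?q ?p //; by polyg.
- case: nuv; apply: (wa3 hwa (t := fun a _ _ c _ _ => g3 v a c)
    (a := (u, u, u)) (b := (v, u, u)) (c := (u, u, u)) (d := (v, u, u)));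
    rewrite /= ?r ?q ?p //; by polyg.
by split.
Qed.

Local Open Scope ring_scope.

(* Binary operations being projections, any two elements form a subalgebra; the
   minority operation of a two-element set is [x + y + z]. *)
Lemma minority_rep (K : fieldType) : (forall k : K, k = 0 \/ k = 1) ->
  (1 + 1 = 0 :> K) ->
  exists psi : representation C K,
    forall x, psi _ g x = x ord0 - x ord31 + x ord_max.
Proof.
move=> K01 char2; have [u [v nuv]] := two_elements hnt.
pose enc (k : K) := if k == 0 then u else v.
have encI : injective enc.
  have o0 : (1 == 0 :> K) = false := oner_eq0 K.
  move=> k l; rewrite /enc; have [->|->] := K01 k; have [->|->] := K01 l;
    by rewrite ?eqxx ?o0 // => /esym.
have enc_closed n (h : C n) (x : 'I_n.+1 -> K) :
    exists k, phi _ h (enc \o x) = enc k.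
  pose s (i : 'I_n.+1) : C 1 := cproj (if x i == 0 then ord0 else ord_max).
  have [i ei] := hbin (ccomp h s).
  have -> : phi _ h (enc \o x) = pr2 u v i.
    have := congr1 (fun h => phi _ h (pr2 u v)) ei.
    rewrite phi_comp phi_proj => <-; congr (phi _ h _); apply: funext => j.
    by rewrite phi_proj /= /enc; case: eqP.
  have [->|->] := ord2_or i; first by exists 0; rewrite /enc eqxx.
  by exists 1; rewrite /enc oner_eq0.
pose psi n (h : C n) : op_clone K n := fun x => projT1 (cid (enc_closed n h x)).
have psiE n (h : C n) x : enc (psi n h x) = phi _ h (enc \o x).
  by rewrite /psi; case: cid.
have psi_proj n (i : 'I_n.+1) : psi n (cproj i) = cproj i.
  by apply: funext => x; apply: encI; rewrite psiE phi_proj.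
have psi_comp n m (h : C n) (t : 'I_n.+1 -> C m) :
    psi m (ccomp h t) = ccomp (psi n h) (fun i => psi m (t i)).
  apply: funext => x; apply: encI; rewrite psiE phi_comp /= psiE.
  by congr (phi _ h _); apply: funext => i; rewrite /= psiE.
exists (CloneHom psi_proj psi_comp) => x /=; apply: encI; rewrite psiE.
have [r q p] := ternary_minority.
rewrite [enc \o x]pr3_eta /=; move: (x ord0) (x ord31) (x ord_max) => a b c.
have opp1 : - 1 = 1 :> K by apply/eqP; rewrite eq_sym -subr_eq0 opprK char2.
have [->|->] := K01 a; have [->|->] := K01 b; have [->|->] := K01 c;
  rewrite ?r ?q ?p; congr enc; rewrite ?opp1 ?oppr0 ?add0r ?addr0 //.
by rewrite char2 add0r.
Qed.

Let sum_one (K : fieldType) (psi : representation C K) n (h : C n) : Prop :=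
  exists c : 'I_n.+1 -> K, \sum_i c i = 1 /\
    forall x, psi _ h x = \sum_i c i * x i.

Fact sum_one_proj K psi n (i : 'I_n.+1) : @sum_one K psi n (cproj i).
Proof.
exists (fun j => (i == j)%:R); split=> [|x].
  by rewrite (bigD1 i) //= eqxx big1 ?addr0 // => j /negPf; rewrite eq_sym => ->.
rewrite phi_proj (bigD1 i) //= eqxx mul1r big1 ?addr0 //.
by move=> j /negPf nji; rewrite eq_sym nji mul0r.
Qed.

Fact sum_one_comp K psi n m (h : C n) (t : 'I_n.+1 -> C m) :
  sum_one psi h -> (forall i, sum_one psi (t i)) -> @sum_one K psi m (ccomp h t).
Proof.
move=> [c [c1 ec]] /choice[d ed].
exists (fun j => \sum_i c i * d i j); split=> [|x].
  rewrite exchange_big -[RHS]c1; apply: eq_bigr => i _ /=.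
  by rewrite -mulr_sumr (ed i).1 mulr1.
rewrite phi_comp ec; under [LHS]eq_bigr => i _ do rewrite ((ed i).2 x) mulr_sumr.
rewrite exchange_big; apply: eq_bigr => j _ /=; rewrite mulr_suml.
by apply: eq_bigr => i _; rewrite mulrA.
Qed.

Definition sum_one_sub (K : fieldType) (psi : representation C K) : subclone C :=
  Subclone (@sum_one_proj K psi) (@sum_one_comp K psi).

Lemma minority_case :
  (exists (A : Type) (phi : representation C A),
    ~ alg_trivial (rep_alg phi) /\ abelian_alg (rep_alg phi)) /\
  exists (p : nat) (V : lmodType 'F_p),
    prime p /\ clone_iso C (affine_clone V).
Proof.
have K01 (k : 'F_2) : k = 0 \/ k = 1.
  by case: k => [[|[|]]] // ?; [left | right]; apply: val_inj.
have char2 : 1 + 1 = 0 :> 'F_2 by apply: val_inj.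
have [psi hpsi] := minority_rep K01 char2.
have K_nat (k : 'F_2) : exists n : nat, k = n%:R.
  by have [->|->] := K01 k; [exists 0%N | exists 1%N].
have lin : forall n (h : C n), sum_one psi h.
  apply: (min_ind hmin (S := sum_one_sub psi) (g := g)) => //.
  exists (pr3 1 (- 1) 1); split=> [|x]; rewrite ?hpsi !big_ord_recl big_ord0.
    by rewrite /pr3 /= addr0 addNr addr0.
  rewrite /pr3 /= mul1r mulN1r mul1r addr0 -addrA.
  by congr (_ + (- x _ + x _)); apply: val_inj.
split; first exact: (affine_abelian_rep lin hpsi).
exists 2%N, ('F_2)^o%type; split=> //; exact: (affine_iso hmin K_nat lin hpsi).
Qed.

End Ternary.
End NoBinary.

(** * Unary operations *)

Section UnaryCase.
Variables (C : abs_clone) (A : Type) (phi : representation C A).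
Hypothesis hmin : clone_minimal C.

Definition ess_unary n (t : op A n) : Prop :=
  exists (i : 'I_n.+1) (u : A -> A), forall x, t x = u (x i).

Lemma ess_unary_comp n m (t : op A n) (s : 'I_n.+1 -> op A m) :
  ess_unary t -> (forall i, ess_unary (s i)) ->
  ess_unary (fun x => t (fun i => s i x)).
Proof.
move=> [i [u eu]] us; have [j [w ew]] := us i.
by exists j, (u \o w) => x; rewrite eu ew.
Qed.

Fact ess_unary_proj n (i : 'I_n.+1) : ess_unary (phi _ (cproj i)).
Proof. by exists i, id => x; rewrite phi_proj. Qed.

Fact ess_unary_ccomp n m (h : C n) (g : 'I_n.+1 -> C m) :
  ess_unary (phi _ h) -> (forall i, ess_unary (phi _ (g i))) ->
  ess_unary (phi _ (ccomp h g)).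
Proof.
move=> uh ug; have [j [w ew]] := ess_unary_comp uh ug.
by exists j, w => x; rewrite phi_comp -ew.
Qed.

Definition ess_unary_sub : subclone C := Subclone ess_unary_proj ess_unary_ccomp.

Variable f : C 0.
Hypothesis npf : ~ is_proj f.

Lemma unary_clone_gen : unary_clone C.
Proof.
split=> //; exists f => n g.
apply: (min_ind hmin (S := gen_subclone _) (g := f)) npf _ _.
exact: Gen_base.
Qed.

(** Every polynomial depends on at most one variable, so in each matrix either both columns or both
    rows coincide. *)
Lemma unary_abelian : abelian_alg (rep_alg phi).
Proof.
have uC n (g : C n) : ess_unary (phi _ g).
  apply: (min_ind hmin (S := ess_unary_sub) _ npf).
  exists ord0, (fun a => phi _ f (fun=> a)) => x.
  by congr (phi _ f _); apply: funext => i; rewrite [i]ord1.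
move=> u v w [n [m [t [a [b [c [d [pt [e1 e2 e3 e4]]]]]]]]].
have [i [h eh]] : ess_unary t.
  elim: pt => [k _ [[l g]|l e]|k i|k l s r _ us _ ur].
  - exact: uC.
  - by exists ord0, (fun=> e).
  - by exists i, id.
  exact: ess_unary_comp.
rewrite !eh /vcat in e1 e2 e3 e4; move: e1 e2 e3 e4.
by case: (@split n.+1 m.+1 i) => j e1 e2 e3 e4; rewrite e3 e4 // -e1 -e2.
Qed.

End UnaryCase.

Theorem theorem5p1 (C : abs_clone) (hmin : clone_minimal C)
  (hrep : exists (A : Type) (phi : representation C A),
    ~ alg_trivial (rep_alg phi) /\ weakly_abelian (rep_alg phi)) :
  (exists (A : Type) (phi : representation C A),
    ~ alg_trivial (rep_alg phi) /\ abelian_alg (rep_alg phi)) /\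
  [\/ unary_clone C,
      exists (p : nat) (V : lmodType 'F_p),
        prime p /\ clone_iso C (affine_clone V),
      exists (G : Type) (mul : G -> G -> G),
        [/\ rectangular_band mul, ~ alg_trivial (groupoid_alg mul)
          & clone_iso C (term_clone (groupoid_alg mul))]
    | exists (p : nat) (G : Type) (mul : G -> G -> G),
        [/\ prime p, cyclic_groupoid p mul \/ cyclic_groupoid p (dual mul),
            ~ alg_trivial (groupoid_alg mul)
          & clone_iso C (term_clone (groupoid_alg mul))]].
Proof.
have [A [phi [hnt hwa]]] := hrep.
have [[f nf]|unary] := classicP (exists f : C 0, ~ is_proj f).
  split; last by apply: Or41; apply: unary_clone_gen nf.
  by exists A, phi; split=> //; apply: unary_abelian nf.
have {}unary (f : C 0) : is_proj f.
  by apply: contrapT => nf; apply: unary; exists f.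
have hid (f : C 1) x : bop phi f x x = x.
  have [i ei] := unary (ccomp f (fun=> cproj ord0)).
  have := congr1 (fun h => phi _ h (fun=> x)) ei; rewrite phi_comp !phi_proj => e.
  rewrite -[RHS]e; congr (phi _ f _); apply: funext => j.
  by rewrite /pr2; case: ifP.
have [[f nf]|binary] := classicP (exists f : C 1, ~ is_proj f).
  (* Both laws are sought among all binary nonprojections: the affine case uses their failure for
     operations derived from [f] too. *)
  have [[g [ng gN]]|hN] := classicP (exists g : C 1, ~ is_proj g /\
      forall x y, bop phi g x (bop phi g x y) = x).
    have [ab iso] := cyclic_case hmin hnt hwa hid ng gN.
    by split=> //; apply: Or44.
  have [[g [ng gR]]|hR] := classicP (exists g : C 1, ~ is_proj g /\
      forall x y, bop phi g x (bop phi g y x) = x).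
    have [ab iso] := rectangular_band_case hmin hnt hwa hid ng gR.
    by split=> //; apply: Or43.
  have {}hN (g : C 1) : ~ is_proj g -> ~ forall x y, bop phi g x (bop phi g x y) = x.
    by move=> ng gN; apply: hN; exists g.
  have {}hR (g : C 1) : ~ is_proj g -> ~ forall x y, bop phi g x (bop phi g y x) = x.
    by move=> ng gR; apply: hR; exists g.
  have [ab iso] := affine_case hmin hnt hwa hid hN hR nf.
  by split=> //; apply: Or42.
have {}binary (f : C 1) : is_proj f.
  by apply: contrapT => nf; apply: binary; exists f.
have [g ng] : exists g : C 2, ~ is_proj g.
  have [n [g ng]] : exists n (g : C n), ~ is_proj g.
    apply: contrapT => h; case: hmin => triv _; apply: triv => n g.
    by apply: contrapT => ng; apply: h; exists n, g.
  elim/ltn_ind: n g ng => -[|[|[|n]]] IH g ng.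
  - by case: (ng (unary g)).
  - by case: (ng (binary g)).
  - by exists g.
  (* Sorts are shifted by one: the index [n.+3] means arity at least four, and the descent ends at
     ternary operations. *)
  have [k [h [kn nh]]] := no_large_arity hmin hnt hwa (isT : 2 < n.+3) ng.
  exact: IH kn h nh.
have [ab iso] := minority_case hmin hnt hwa binary ng.
by split=> //; apply: Or42.
Qed.
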